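(* Suppose $\mathbb{F}$ is algebraically closed (of characteristic not $2$ or $3$). Then, with $\zeta_s,\zeta_g,\Psi_3,\tilde\Psi_3$ the maps defined in the context: 1. $\zeta_s:\mathcal{A}^c_3/SL(V)\to\Gamma^*_{\mathrm{Eisenstein}}$ is a bijection; 2. $\zeta_g:\mathcal{A}^c_3/GL(V)\to\widetilde{\mathbb{P}}(\Gamma^*_{\mathrm{Eisenstein}})$ is a bijection; 3. $\zeta_s:\mathcal{A}^c_{\mathrm{st}}/SL(V)\to\Gamma_{\mathrm{Eisenstein}}$ is a bijection; 4. $\zeta_g:\mathcal{A}^c_{\mathrm{st}}/GL(V)\to\widetilde{\mathbb{P}}(\Gamma_{\mathrm{Eisenstein}})$ is a bijection; 5. $\Psi_3:\widetilde{\mathbb{P}}(\Gamma^*_{\mathrm{Eisenstein}})\to\mathbb{F}^2$ is a bijection; 6. $\tilde\Psi_3:\widetilde{\mathbb{P}}(\Gamma_{\mathrm{Eisenstein}})\to\mathbb{P}^2$ is a bijection.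
   Context: $V$ is a two-dimensional $\mathbb{F}$-vector space. $L=\Lambda^2(V^* )$ is the one-dimensional space of antisymmetric bilinear forms on $V$, $L^r$ its $r$-th tensor power, with $L^r\otimes L^s=L^{r+s}$. $\mathcal{A}^c$ is the set of symmetric bilinear maps $m:V\times V\to V$. $GL(V)$, and hence $SL(V)$, acts on $\mathcal{A}^c$ by $(g\cdot m)(v,w)=g\big(m(g^{-1}v,g^{-1}w)\big)$. Let $(e_1,e_2)$ be a basis of $V$ with dual basis $(\epsilon_1,\epsilon_2)$, put $\omega=\epsilon_1\wedge\epsilon_2$, and write $m(e_1,e_1)=ae_1+be_2$, $m(e_2,e_2)=ce_1+de_2$, $m(e_1,e_2)=ee_1+fe_2$. The fundamental cubic is $Q_m(v)=m(v,v)\wedge v$; thus $Q_m(xe_1+ye_2)=q(x,y)\,e_1\wedge e_2$ with $q(x,y)=-bx^3+(a-2f)x^2y+(2e-d)xy^2+cy^3$. Writing $q=A_0x^3+B_0x^2y+C_0xy^2+D_0y^3$, $\mathrm{Disc}(Q_m)=(18A_0B_0C_0D_0+B_0^2C_0^2-4A_0C_0^3-4B_0^3D_0-27A_0^2D_0^2)\,\omega^2\in L^2$. Put $\mu(x,y)=q_{xx}q_{yy}-q_{xy}^2$, $G(x,y)=q_x\mu_y-q_y\mu_x$, $\tau=(d+e,-(a+f))$. Define $\tilde p_3(m)=-8q(\tau)\omega^2\in L^2$, $\tilde p_2(m)=\mu(\tau)\omega^2\in L^2$, $\mathrm{Inv}_m=\frac1{54}G(\tau)\omega^3\in L^3$ (all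 independent of the basis). $\mathcal{A}^c_3=\{m:\mathrm{Disc}(Q_m)\ne0\}$ (generic algebras); $\mathcal{A}^c_{\mathrm{st}}$ (stable algebras, which contain $\mathcal{A}^c_3$) is the set of $m\in\mathcal{A}^c$ for which there is an $SL(V)$-invariant homogeneous polynomial $F$ of positive degree on $\mathcal{A}^c$ with $F(m)\neq0$. $\Gamma_{\mathrm{Eisenstein}}=\{(A,B,D,C)\in(L^2\times L^2\times L^2\times L^3)\setminus\{0\}:27DA^2+4B^3+2^43^6C^2=0\}$ and $\Gamma^*_{\mathrm{Eisenstein}}=\{(A,B,D,C)\in\Gamma_{\mathrm{Eisenstein}}:D\ne0\}$. $\mathbb{F}^*$ acts on both by $\lambda\cdot(A,B,D,C)=(\lambda^{-2}A,\lambda^{-2}B,\lambda^{-2}D,\lambda^{-3}C)$, and $\widetilde{\mathbb{P}}(\cdot)$ denotes the quotient by this action. The map $m\mapsto(\tilde p_3(m),\tilde p_2(m),\mathrm{Disc}(Q_m),\mathrm{Inv}_m)$ induces $\zeta_s:\mathcal{A}^c_{\mathrm{st}}/SL(V)\to\Gamma_{\mathrm{Eisenstein}}$ and, by passing to the quotient, $\zeta_g:\mathcal{A}^c_{\mathrm{st}}/GL(V)\to\widetilde{\mathbb{P}}(\Gamma_{\mathrm{Eisenstein}})$; the same symbols denote their restrictions to $\mathcal{A}^c_3/SL(V)$ and $\mathcal{A}^c_3/GL(V)$, with values in $\Gamma^*_{\mathrm{Eisenstein}}$ and $\widetilde{\mathbb{P}}(\Gamma^*_{\mathrm{Eisenstein}})$.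 Finally $\Psi_3([A,B,D,C])=(A/D,B/D)\in\mathbb{F}^2$, and $\tilde\Psi_3([A,B,D,C])=[A,B,D]\in\mathbb{P}^2$, where $\mathbb{P}^2$ is the projective plane of $L^2\oplus L^2\oplus L^2$, canonically identified with the projective plane over $\mathbb{F}$ since $L^2$ is one-dimensional. *)

(* Defs.v *)
From HB Require Import structures.
From mathcomp Require Import all_boot all_order all_algebra.
From mathcomp Require Import boolp classical_sets functions.
From mathcomp Require Import mpoly ring.

Set Implicit Arguments.
Unset Strict Implicit.
Unset Printing Implicit Defensive.

Import GRing.Theory.
Local Open Scope ring_scope.

Section BilinearMaps.
Variables (F : fieldType) (V W : vectType F).

(* Bilinear maps V x V -> W are elements of 'Hom(V, 'Hom(V, W)). *)
Definition bilfun (f : V -> V -> W) : 'Hom(V, 'Hom(V, W)) :=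
  linfun (fun v => linfun (f v)).

Definition flipb (m : 'Hom(V, 'Hom(V, W))) := bilfun (fun v w => m w v).

Definition symv : {vspace 'Hom(V, 'Hom(V, W))} := lker (linfun flipb - \1)%VF.

Definition antisymv : {vspace 'Hom(V, 'Hom(V, W))} :=
  lker (linfun flipb + \1)%VF.

End BilinearMaps.

Section BilinearMapsTheory.
Variable F : fieldType.

Lemma linfun_lin (U W : vectType F) (f : U -> W) : linear f -> linfun f =1 f.
Proof.
move=> fl v.
pose fL := GRing.isLinear.Build F U W *:%R f fl.
pose g : {linear U -> W} := HB.pack f fL.
exact: (lfunE g).
Qed.

Variables (V W : vectType F).

Lemma bilfunE (f : V -> V -> W) :
    (forall v, linear (f v)) -> (forall w, linear (f^~ w)) ->
  forall v w, bilfun f v w = f v w.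
Proof.
move=> lr ll v w; rewrite /bilfun !linfun_lin // => a x y.
apply/lfunP => z; rewrite !lfunE /= linfun_lin // lfunE /= !linfun_lin //.
exact: (ll z a x y).
Qed.

Lemma flipbE (m : 'Hom(V, 'Hom(V, W))) v w : flipb m v w = m w v.
Proof.
rewrite bilfunE // => u a x y; last by rewrite linearP.
by rewrite linearP add_lfunE scale_lfunE.
Qed.

Lemma linfun_flipbE (m : 'Hom(V, 'Hom(V, W))) : linfun (@flipb F V W) m = flipb m.
Proof.
rewrite linfun_lin // => a x y; apply/lfunP => v; apply/lfunP => w.
by rewrite !(flipbE, add_lfunE, scale_lfunE).
Qed.

Lemma symvP (m : 'Hom(V, 'Hom(V, W))) :
  reflect (forall v w, m v w = m w v) (m \in symv V W).
Proof.
rewrite memv_ker !lfunE /= linfun_flipbE lfunE /= lfunE /= subr_eq0.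
apply: (iffP eqP) => [h v w|h]; first by rewrite -{1}h flipbE.
by apply/lfunP => v; apply/lfunP => w; rewrite flipbE h.
Qed.

Lemma antisymvP (m : 'Hom(V, 'Hom(V, W))) :
  reflect (forall v w, m v w = - m w v) (m \in antisymv V W).
Proof.
rewrite memv_ker !lfunE /= linfun_flipbE lfunE /= addr_eq0.
apply: (iffP eqP) => [h v w|h].
  by rewrite -[in RHS]flipbE h !lfunE opprK.
by apply/lfunP => v; apply/lfunP => w; rewrite flipbE h !lfunE.
Qed.

End BilinearMapsTheory.

Section Algebras.
Variables (F : fieldType) (V : vectType F).

Definition calg : vectType F := subvs_of (symv V V).

Definition mul (m : calg) : V -> V -> V := fun v w => vsval m v w.

Lemma mulC m v w : mul m v w = mul m w v.
Proof. by apply/symvP/subvsP. Qed.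

(* Injectivity amounts to invertibility in finite dimension. *)
Definition inGL (g : 'End(V)) : Prop := lker g == 0%VS.

Definition lfdet (g : 'End(V)) : F :=
  \det (passmx.mxof (vbasis {:V}) (vbasis {:V}) g).

Definition inSL (g : 'End(V)) : Prop := inGL g /\ lfdet g = 1.

Definition act (g : 'End(V)) (m : calg) : calg :=
  vsproj (symv V V)
    (bilfun (fun v w => g (mul m ((g^-1)%VF v) ((g^-1)%VF w)))).

Lemma actE g m v w : mul (act g m) v w = g (mul m ((g^-1)%VF v) ((g^-1)%VF w)).
Proof.
have E v' w' : bilfun (fun v w => g (mul m ((g^-1)%VF v) ((g^-1)%VF w))) v' w' =
    g (mul m ((g^-1)%VF v') ((g^-1)%VF w')).
  rewrite bilfunE // => u a x y; rewrite /mul; first by rewrite !linearP.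
  by rewrite linearP [vsval m _]linearP add_lfunE scale_lfunE linearP.
rewrite [LHS]/mul vsprojK ?E //; apply/symvP => v' w'.
by rewrite !E mulC.
Qed.

Lemma calgP (m m' : calg) : (forall v w, mul m v w = mul m' v w) -> m = m'.
Proof. by move=> h; apply/val_inj/lfunP => v; apply/lfunP => w; apply: h. Qed.

Lemma act1 m : act \1%VF m = m.
Proof.
apply/calgP => v w; rewrite actE id_lfunE.
suff h u : (\1%VF : 'End(V))^-1%VF u = u by rewrite !h.
have k0 : lker (\1%VF : 'End(V)) == 0%VS.
  by apply/lker0P => x y; rewrite !id_lfunE.
by rewrite -[RHS](lker0_lfunK k0) id_lfunE.
Qed.

Lemma inGL1 : inGL \1%VF.
Proof. by apply/lker0P => x y; rewrite !id_lfunE. Qed.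

Lemma inGLM g h : inGL g -> inGL h -> inGL (g \o h)%VF.
Proof.
move=> /lker0P gi /lker0P hi; apply/lker0P => x y.
by rewrite !comp_lfunE => /gi /hi.
Qed.

Lemma inGLV g : inGL g -> inGL (g^-1)%VF.
Proof.
by move=> gi; apply/lker0P; apply: can_inj; apply: lker0_lfunVK.
Qed.

Lemma actM g h m : inGL g -> inGL h -> act (g \o h)%VF m = act g (act h m).
Proof.
move=> gi hi; apply/calgP => v w; rewrite !actE comp_lfunE.
suff E u : ((g \o h)^-1)%VF u = (h^-1)%VF ((g^-1)%VF u) by rewrite !E.
apply: (can_inj (lker0_lfunK (inGLM gi hi))).
by rewrite (lker0_lfunVK (inGLM gi hi)) comp_lfunE !lker0_lfunVK.
Qed.

Lemma actK g m : inGL g -> act (g^-1)%VF (act g m) = m.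
Proof.
move=> gi; by rewrite -(actM _ (inGLV gi) gi) lker0_compVf // act1.
Qed.

Lemma lfdet1 : lfdet \1%VF = 1.
Proof. by rewrite /lfdet passmx.mxof1 ?det1 // (basis_free (vbasisP _)). Qed.

Lemma lfdetM g h : lfdet (g \o h)%VF = lfdet g * lfdet h.
Proof.
rewrite /lfdet (passmx.mxof_comp _ _ (vbasisP _)) det_mulmx mulrC //.
Qed.

Lemma inSLM g h : inSL g -> inSL h -> inSL (g \o h)%VF.
Proof.
by move=> [gi g1] [hi h1]; split; [apply: inGLM | rewrite lfdetM g1 h1 mulr1].
Qed.

Lemma inSLV g : inSL g -> inSL (g^-1)%VF.
Proof.
move=> [gi g1]; split; first exact: inGLV.
by rewrite -[LHS]mulr1 -g1 -lfdetM lker0_compVf // lfdet1.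
Qed.

Definition orb (G : 'End(V) -> Prop) : rel calg :=
  fun m m' => `[< exists2 g, G g & m' = act g m >].

Lemma SLorb_refl : reflexive (orb inSL).
Proof.
move=> m; apply/asboolP; exists \1%VF; last by rewrite act1.
by split; [apply: inGL1 | apply: lfdet1].
Qed.

Lemma SLorb_sym : ssrbool.symmetric (orb inSL).
Proof.
suff h m m' : orb inSL m m' -> orb inSL m' m by move=> m m'; apply/idP/idP; apply: h.
move=> /asboolP [g gS ->]; apply/asboolP; exists (g^-1)%VF; first exact: inSLV.
by rewrite actK //; case: gS.
Qed.

Lemma SLorb_trans : transitive (orb inSL).
Proof.
move=> m2 m1 m3 /asboolP [g gS ->] /asboolP [h hS ->]; apply/asboolP.
exists (h \o g)%VF; first exact: inSLM.
by rewrite actM //; [case: hS | case: gS].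
Qed.

Lemma GLorb_refl : reflexive (orb inGL).
Proof.
by move=> m; apply/asboolP; exists \1%VF; rewrite ?act1 //; apply: inGL1.
Qed.

Lemma GLorb_sym : ssrbool.symmetric (orb inGL).
Proof.
suff h m m' : orb inGL m m' -> orb inGL m' m by move=> m m'; apply/idP/idP; apply: h.
move=> /asboolP [g gS ->]; apply/asboolP; exists (g^-1)%VF; first exact: inGLV.
by rewrite actK.
Qed.

Lemma GLorb_trans : transitive (orb inGL).
Proof.
move=> m2 m1 m3 /asboolP [g gS ->] /asboolP [h hS ->]; apply/asboolP.
by exists (h \o g)%VF; [apply: inGLM | rewrite actM].
Qed.

Definition SLeq : equiv_rel calg := EquivRel (orb inSL) SLorb_refl SLorb_sym SLorb_trans.
Definition GLeq : equiv_rel calg := EquivRel (orb inGL) GLorb_refl GLorb_sym GLorb_trans.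

(* The quotient of an invariant subset S of calg is the set of classes of
   its elements, that is, the image of S in calg_SL or calg_GL. *)
Definition calg_SL := {eq_quot SLeq}%qT.
Definition calg_GL := {eq_quot GLeq}%qT.

(* The value at w of the polynomial function given by p in the coordinates of
   a basis; being homogeneous of degree d does not depend on that basis. *)
Definition polyfun (W : vectType F) (p : {mpoly F[\dim {:W}]}) (w : W) : F :=
  p.@[fun i => coord (vbasis {:W}) i w].

Definition stable : set calg :=
  [set m | exists d (p : {mpoly F[\dim {:calg}]}),
    [/\ (0 < d)%N, p \is d.-homog,
        forall g m', inSL g -> polyfun p (act g m') = polyfun p m'
      & polyfun p m != 0]]%classic.

End Algebras.

Section Lines.
Variables (F : fieldType) (V : vectType F).

Definition lline : vectType F := subvs_of (antisymv V F^o).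

(* Tensor powers of L : the tensor product of the finite-dimensional spaces L
   and W is taken in the form Hom(L^*, W), where x (x) w is the map
   phi |-> phi(x) w. *)
Fixpoint lpow (r : nat) : vectType F :=
  if r is r'.+1 then 'Hom('Hom(lline, F^o), lpow r') else F^o.

Definition tcons r (x : lline) (t : lpow r) : lpow r.+1 :=
  linfun (fun phi : 'Hom(lline, F^o) => (phi x : F) *: t).

Fixpoint tpow (r : nat) (x : lline) : lpow r :=
  if r is r'.+1 then tcons x (tpow r' x) else (1 : F).

(* The identification of L^r (x) L^s with L^(r + s). *)
Fixpoint tmul (r s : nat) : lpow r -> lpow s -> lpow (r + s) :=
  match r with
  | 0 => fun x y => (x : F) *: y
  | r'.+1 => fun x y =>
      linfun (fun phi : 'Hom(lline, F^o) => tmul (x phi) y)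
  end.

Lemma tconsE r (x : lline) (t : lpow r) (phi : 'Hom(lline, F^o)) :
  tcons x t phi = (phi x : F) *: t.
Proof.
by rewrite /tcons linfun_lin // => a f g; rewrite add_lfunE scale_lfunE scalerDl scalerA.
Qed.

Lemma tmulDl r s (x x' : lpow r) (y : lpow s) k :
  tmul (k *: x + x') y = k *: tmul x y + tmul x' y.
Proof.
elim: r k x x' => [|r IH] k x x' /=; first by rewrite scalerDl scalerA.
have lin (z : lpow r.+1) :
    linear (fun phi : 'Hom(lline, F^o) => tmul (z phi) y).
  by move=> a f g; rewrite linearP; exact: IH.
apply/lfunP => phi; rewrite linfun_lin; last exact: lin.
have -> : (k *: x + x' : lpow r.+1) phi = k *: (x phi : lpow r) + x' phi.
  by rewrite /= add_lfunE scale_lfunE.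
rewrite IH -(linfun_lin (lin x)) -(linfun_lin (lin x')) /=.
by rewrite add_lfunE scale_lfunE.
Qed.

Lemma tmulZl r s (x : lpow r) (y : lpow s) k : tmul (k *: x) y = k *: tmul x y.
Proof.
have t0 : tmul (0 : lpow r) y = 0.
  by rewrite -[X in tmul X y](addNr x) -scaleN1r tmulDl scaleN1r addNr.
by rewrite -[k *: x]addr0 tmulDl t0 addr0.
Qed.

Lemma tmul_tpow r s (x : lline) :
  tmul (tpow r x) (tpow s x) = tpow (r + s) x.
Proof.
elim: r => [|r IH] /=; first by rewrite scale1r.
apply/lfunP => phi; rewrite [RHS]tconsE -IH linfun_lin; last first.
  by move=> a f g; rewrite linearP; exact: tmulDl.
by rewrite tconsE tmulZl.
Qed.

Definition wedge (a b : 'Hom(V, F^o)) : lline :=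
  vsproj (antisymv V F^o) (bilfun (fun v w => a v * b w - b v * a w : F^o)).

Lemma wedgeE a b v w : vsval (wedge a b) v w = a v * b w - b v * a w.
Proof.
have E v' w' : bilfun (fun v w => a v * b w - b v * a w : F^o) v' w' =
    a v' * b w' - b v' * a w'.
  rewrite bilfunE // => u c x y; rewrite !linearP /= /GRing.scale /=; ring.
rewrite vsprojK ?E //; apply/antisymvP => v' w'; rewrite !E; ring.
Qed.

End Lines.

Arguments tpow {F V} r x.

Section WeightedQuotient.
Variables (F : fieldType) (V : vectType F).

(* The components are, in order, A, B, D and C. *)
Definition lquad : Type := (lpow V 2 * lpow V 2 * lpow V 2 * lpow V 3)%type.
HB.instance Definition _ := GRing.Zmodule.on lquad.

Definition wscale (k : F) (x : lquad) : lquad :=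
  let: (A, B, D, C) := x in (k ^- 2 *: A, k ^- 2 *: B, k ^- 2 *: D, k ^- 3 *: C).

Definition worb : rel lquad :=
  fun x y => `[< exists2 k : F, k != 0 & y = wscale k x >].

Lemma wscale1 x : wscale 1 x = x.
Proof. by case: x => [[[A B] D] C]; rewrite /wscale !expr1n invr1 !scale1r. Qed.

Lemma wscaleM k l x : wscale k (wscale l x) = wscale (k * l) x.
Proof.
by case: x => [[[A B] D] C]; rewrite /wscale !scalerA !exprMn !invfM.
Qed.

Lemma worb_refl : reflexive worb.
Proof. by move=> x; apply/asboolP; exists 1; rewrite ?oner_eq0 ?wscale1. Qed.

Lemma worb_sym : ssrbool.symmetric worb.
Proof.
suff h x y : worb x y -> worb y x by move=> x y; apply/idP/idP; apply: h.
move=> /asboolP [k k0 ->]; apply/asboolP; exists k^-1; first by rewrite invr_eq0.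
by rewrite wscaleM mulVf // wscale1.
Qed.

Lemma worb_trans : transitive worb.
Proof.
move=> y x z /asboolP [k k0 ->] /asboolP [l l0 ->]; apply/asboolP.
by exists (l * k); rewrite ?wscaleM // mulf_neq0.
Qed.

Definition weq : equiv_rel lquad := EquivRel worb worb_refl worb_sym worb_trans.
Definition wproj := {eq_quot weq}%qT.

Definition syzygy (A B D : lpow V 2) (C : lpow V 3) : lpow V 6 :=
  27%:R *: tmul D (tmul A A) + 4%:R *: tmul B (tmul B B)
    + (2%:R ^+ 4 * 3%:R ^+ 6) *: tmul C C.

Definition Eisenstein : set lquad :=
  [set x : lquad | x != 0 /\ let: (A, B, D, C) := x in syzygy A B D C = 0]%classic.

Definition Eisenstein_star : set lquad :=
  [set x : lquad | Eisenstein x /\ let: (A, B, D, C) := x in D != 0]%classic.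

End WeightedQuotient.

Section ProjectiveSpace.
Variables (F : fieldType) (W : vectType F).

Definition sorb : rel W := fun x y => `[< exists2 k : F, k != 0 & y = k *: x >].

Lemma sorb_refl : reflexive sorb.
Proof. by move=> x; apply/asboolP; exists 1; rewrite ?oner_eq0 ?scale1r. Qed.

Lemma sorb_sym : ssrbool.symmetric sorb.
Proof.
suff h x y : sorb x y -> sorb y x by move=> x y; apply/idP/idP; apply: h.
move=> /asboolP [k k0 ->]; apply/asboolP; exists k^-1; first by rewrite invr_eq0.
by rewrite scalerA mulVf // scale1r.
Qed.

Lemma sorb_trans : transitive sorb.
Proof.
move=> y x z /asboolP [k k0 ->] /asboolP [l l0 ->]; apply/asboolP.
by exists (l * k); rewrite ?scalerA // mulf_neq0.
Qed.

Definition ray_rel : equiv_rel W := EquivRel sorb sorb_refl sorb_sym sorb_trans.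

(* W modulo nonzero scalars, including the class of 0. *)
Definition rays := {eq_quot ray_rel}%qT.

Definition proj_space : set rays := [set \pi_rays w | w in [set w : W | w != 0]]%classic%qT.

End ProjectiveSpace.

Section Invariants.
Variables (F : fieldType) (V : vectType F) (e : 2.-tuple V).
Implicit Type m : calg V.

Let e1 := e`_0.
Let e2 := e`_1.

Definition sc_a m := coord e 0 (mul m e1 e1).
Definition sc_b m := coord e 1 (mul m e1 e1).
Definition sc_c m := coord e 0 (mul m e2 e2).
Definition sc_d m := coord e 1 (mul m e2 e2).
Definition sc_e m := coord e 0 (mul m e1 e2).
Definition sc_f m := coord e 1 (mul m e1 e2).

Definition omega : lline V :=
  wedge (linfun (coord e 0 : V -> F^o)) (linfun (coord e 1 : V -> F^o)).

Definition cA m := - sc_b m.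
Definition cB m := sc_a m - 2%:R * sc_f m.
Definition cC m := 2%:R * sc_e m - sc_d m.
Definition cD m := sc_c m.

(* The polynomial q with Q_m(x e1 + y e2) = q(x, y) e1 /\ e2; see
   cubic_fundamental below. *)
Definition cubic m : {mpoly F[2]} :=
  cA m *: 'X_0 ^+ 3 + cB m *: ('X_0 ^+ 2 * 'X_1)
    + cC m *: ('X_0 * 'X_1 ^+ 2) + cD m *: 'X_1 ^+ 3.

Definition hess m : {mpoly F[2]} :=
  let q := cubic m in
  q^`M(0)^`M(0) * q^`M(1)^`M(1) - q^`M(0)^`M(1) ^+ 2.

Definition jacob m : {mpoly F[2]} :=
  let q := cubic m in let h := hess m in q^`M(0) * h^`M(1) - q^`M(1) * h^`M(0).

Definition tau m : 'I_2 -> F := tnth [tuple sc_d m + sc_e m; - (sc_a m + sc_f m)].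

Definition p3 m : lpow V 2 := (- 8%:R * (cubic m).@[tau m]) *: tpow 2 omega.

Definition p2 m : lpow V 2 := (hess m).@[tau m] *: tpow 2 omega.

Definition disc m : lpow V 2 :=
  (18%:R * cA m * cB m * cC m * cD m + cB m ^+ 2 * cC m ^+ 2
    - 4%:R * cA m * cC m ^+ 3 - 4%:R * cB m ^+ 3 * cD m
    - 27%:R * cA m ^+ 2 * cD m ^+ 2) *: tpow 2 omega.

Definition Inv m : lpow V 3 := (54%:R^-1 * (jacob m).@[tau m]) *: tpow 3 omega.

Definition invs m : lquad V := (p3 m, p2 m, disc m, Inv m).

Definition generic : set (calg V) := [set m | disc m != 0]%classic.

(* The values at a class do not depend on the representative: see zeta_s_pi
   and zeta_g_pi below. *)
Definition zeta_s (x : calg_SL V) : lquad V := invs (repr x).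

Definition zeta_g (x : calg_GL V) : wproj V := \pi_(wproj V)%qT (invs (repr x)).

End Invariants.

Section InvariantsTheory.
Variables (F : fieldType).

Lemma mderivXi (i j : 'I_2) : ('X_i : {mpoly F[2]})^`M(j) = (i == j)%:R%:MP.
Proof.
rewrite mderivX mnm1E; case: eqVneq => [->|_]; last by rewrite scale0r mpolyC0.
suff -> : (U_(j) - U_(j) = 0 :> 'X_{1..2})%MM by rewrite scale1r mpolyX0 mpolyC1.
by apply/mnmP => k; rewrite mnmBE subnn mnm0E.
Qed.

Section Forms.
Variables A B C D : F.
Let X : {mpoly F[2]} := 'X_0.
Let Y : {mpoly F[2]} := 'X_1.
Let dX0 : X^`M(0) = 1. Proof. by rewrite mderivXi mpolyC1. Qed.
Let dX1 : X^`M(1) = 0. Proof. by rewrite mderivXi mpolyC0. Qed.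
Let dY0 : Y^`M(0) = 0. Proof. by rewrite mderivXi mpolyC0. Qed.
Let dY1 : Y^`M(1) = 1. Proof. by rewrite mderivXi mpolyC1. Qed.
Let q : {mpoly F[2]} := A *: X ^+ 3 + B *: (X ^+ 2 * Y) + C *: (X * Y ^+ 2) + D *: Y ^+ 3.
Let dE := (mderivB, mderivD, mderivN, mderivZ, mderivM, mderivC, dX0, dX1, dY0, dY1).

Lemma cubic_dx : q^`M(0) = (3%:R * A)%:MP * (X * X) + (2%:R * B)%:MP * (X * Y) + C%:MP * (Y * Y).
Proof. by rewrite /q !exprS expr0 !dE -!mul_mpolyC; ring. Qed.

Lemma cubic_dy : q^`M(1) = B%:MP * (X * X) + (2%:R * C)%:MP * (X * Y) + (3%:R * D)%:MP * (Y * Y).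
Proof. by rewrite /q !exprS expr0 !dE -!mul_mpolyC; ring. Qed.

Let h := q^`M(0)^`M(0) * q^`M(1)^`M(1) - q^`M(0)^`M(1) ^+ 2.
Lemma hess_form : h = (12%:R * A * C - 4%:R * B ^+ 2)%:MP * (X * X) + (36%:R * A * D - 4%:R * B * C)%:MP * (X * Y)
  + (12%:R * B * D - 4%:R * C ^+ 2)%:MP * (Y * Y).
Proof. rewrite /h cubic_dx cubic_dy !dE; ring. Qed.

Lemma jacob_form : q^`M(0) * h^`M(1) - q^`M(1) * h^`M(0) =
  ((3%:R * A)%:MP * (X * X) + (2%:R * B)%:MP * (X * Y) + C%:MP * (Y * Y)) *
  ((36%:R * A * D - 4%:R * B * C)%:MP * X + (2%:R * (12%:R * B * D - 4%:R * C ^+ 2))%:MP * Y)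
  - (B%:MP * (X * X) + (2%:R * C)%:MP * (X * Y) + (3%:R * D)%:MP * (Y * Y))
   * ((2%:R * (12%:R * A * C - 4%:R * B ^+ 2))%:MP * X + (36%:R * A * D - 4%:R * B * C)%:MP * Y).
Proof. rewrite cubic_dx cubic_dy hess_form !dE; ring. Qed.
End Forms.

Definition fq (A B C D x y : F) := A * x ^+ 3 + B * (x ^+ 2 * y) + C * (x * y ^+ 2) + D * y ^+ 3.
Definition fh (A B C D x y : F) := (12%:R * A * C - 4%:R * B ^+ 2) * x ^+ 2
  + (36%:R * A * D - 4%:R * B * C) * (x * y) + (12%:R * B * D - 4%:R * C ^+ 2) * y ^+ 2.
Definition fj (A B C D x y : F) :=
  (3%:R * A * x ^+ 2 + 2%:R * B * (x * y) + C * y ^+ 2) *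
  ((36%:R * A * D - 4%:R * B * C) * x + 2%:R * (12%:R * B * D - 4%:R * C ^+ 2) * y)
  - (B * x ^+ 2 + 2%:R * C * (x * y) + 3%:R * D * y ^+ 2)
   * (2%:R * (12%:R * A * C - 4%:R * B ^+ 2) * x + (36%:R * A * D - 4%:R * B * C) * y).
Definition fd (A B C D : F) :=
  18%:R * A * B * C * D + B ^+ 2 * C ^+ 2
    - 4%:R * A * C ^+ 3 - 4%:R * B ^+ 3 * D - 27%:R * A ^+ 2 * D ^+ 2.

Section Cov.
Variables p r s t A B C D x y : F.
Let d := p * t - r * s.
Let A' := fq A B C D p r.
Let B' := 3%:R * A * p ^+ 2 * s + B * (p ^+ 2 * t + 2%:R * p * r * s)
   + C * (2%:R * p * r * t + r ^+ 2 * s) + 3%:R * D * r ^+ 2 * t.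
Let C' := 3%:R * A * p * s ^+ 2 + B * (s ^+ 2 * r + 2%:R * p * s * t)
   + C * (2%:R * r * s * t + t ^+ 2 * p) + 3%:R * D * r * t ^+ 2.
Let D' := fq A B C D s t.
Let x' := t * x - s * y.
Let y' := p * y - r * x.
Lemma fq_cov : fq A' B' C' D' x' y' = d ^+ 3 * fq A B C D x y.
Proof. rewrite /x' /y' /A' /B' /C' /D' /fq /d; ring. Qed.

Lemma fh_cov : fh A' B' C' D' x' y' = d ^+ 4 * fh A B C D x y.
Proof. rewrite /x' /y' /A' /B' /C' /D' /fh /fq /d; ring. Qed.

Lemma fj_cov : fj A' B' C' D' x' y' = d ^+ 6 * fj A B C D x y.
Proof. rewrite /x' /y' /A' /B' /C' /D' /fj /fq /d; ring. Qed.

Lemma fd_cov : fd A' B' C' D' = d ^+ 6 * fd A B C D.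
Proof. rewrite /x' /y' /A' /B' /C' /D' /fd /fq /d; ring. Qed.
End Cov.

Lemma weights (d v1 v2 v3 v4 z : F) : d != 0 ->
  [/\ - 8%:R * (d^-1 * (d ^+ 3 * v1)) = d^-1 ^- 2 * (- 8%:R * v1),
      d^-1 ^+ 2 * (d ^+ 4 * v2) = d^-1 ^- 2 * v2,
      d^-1 ^+ 4 * (d ^+ 6 * v3) = d^-1 ^- 2 * v3
    & z * (d^-1 ^+ 3 * (d ^+ 6 * v4)) = d^-1 ^- 3 * (z * v4)].
Proof. by move=> d0; split; field; rewrite d0 oner_eq0. Qed.

Variable V : vectType F.
Implicit Type m : calg V.

Section Evaluation.
Variable e : 2.-tuple V.
Let mE := (mevalB, mevalD, mevalN, mevalZ, mevalM, mevalC, mevalXU).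
Lemma cubicE m (v : 'I_2 -> F) :
  (cubic e m).@[v] = fq (cA e m) (cB e m) (cC e m) (cD e m) (v 0) (v 1).
Proof. by rewrite /cubic !exprS expr0 !mE /fq; ring. Qed.

Lemma hessE m (v : 'I_2 -> F) :
  (hess e m).@[v] = fh (cA e m) (cB e m) (cC e m) (cD e m) (v 0) (v 1).
Proof. by rewrite /hess /cubic hess_form !mE /fh; ring. Qed.

Lemma jacobE m (v : 'I_2 -> F) :
  (jacob e m).@[v] = fj (cA e m) (cB e m) (cC e m) (cD e m) (v 0) (v 1).
Proof. by rewrite /jacob /hess /cubic jacob_form !mE /fj; ring. Qed.

End Evaluation.

Lemma lfdet_basis n (e : n.-tuple V) (g : 'End(V)) : basis_of {:V} e ->
  lfdet g = \det (\matrix_(i < n, j < n) coord e j (g e`_i)).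
Proof.
move=> eb; have n_eq : n = \dim {:V} by rewrite (vector.size_basis eb).
move: e eb; rewrite {}n_eq => e eb.
have -> : (\matrix_(i, j) coord e j (g e`_i)) = passmx.mxof e e g.
  by apply/matrixP => i j; rewrite !mxE /= passmx.vecof_delta.
have vb := vbasisP {:V}.
have -> : passmx.mxof e e g = passmx.mxof e (vbasis {:V}) \1%VF *m
   (passmx.mxof (vbasis {:V}) (vbasis {:V}) g *m passmx.mxof (vbasis {:V}) e \1%VF).
  by rewrite -!(passmx.mxof_comp _ _ vb) comp_lfun1l comp_lfun1r.
rewrite !det_mulmx mulrCA -det_mulmx -(passmx.mxof_comp _ _ vb) comp_lfun1l.
by rewrite passmx.mxof1 ?det1 ?mulr1 // (basis_free eb).
Qed.

Variable e : 2.-tuple V.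
Hypothesis eb : basis_of {:V} e.
Let e1 := e`_0.
Let e2 := e`_1.

Lemma coord2 v : v = coord e 0 v *: e1 + coord e 1 v *: e2.
Proof.
rewrite {1}(coord_basis eb (memvf v)) !big_ord_recl big_ord0 addr0 /=.
by congr (_ *: _ + coord e _ v *: _); apply/val_inj.
Qed.

Let c00 : coord e 0 e1 = 1. Proof. exact: (coord_free 0 0 (basis_free eb)). Qed.
Let c01 : coord e 0 e2 = 0. Proof. exact: (coord_free 1 0 (basis_free eb)). Qed.
Let c10 : coord e 1 e1 = 0. Proof. exact: (coord_free 0 1 (basis_free eb)). Qed.
Let c11 : coord e 1 e2 = 1. Proof. exact: (coord_free 1 1 (basis_free eb)). Qed.

Lemma mulDr m u v w : mul m u (v + w) = mul m u v + mul m u w.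
Proof. by rewrite /mul linearD. Qed.

Lemma mulZr m u k w : mul m u (k *: w) = k *: mul m u w.
Proof. by rewrite /mul linearZ. Qed.

Lemma mulDl m u v w : mul m (u + v) w = mul m u w + mul m v w.
Proof. by rewrite mulC mulDr !(mulC m w). Qed.

Lemma mulZl m k u w : mul m (k *: u) w = k *: mul m u w.
Proof. by rewrite mulC mulZr mulC. Qed.

Lemma mul2 m x y z w : mul m (x *: e1 + y *: e2) (z *: e1 + w *: e2) =
  (x * z) *: mul m e1 e1 + (x * w + y * z) *: mul m e1 e2 + (y * w) *: mul m e2 e2.
Proof.
have -> : (x * w + y * z) *: mul m e1 e2 = (x * w) *: mul m e1 e2 + (y * z) *: mul m e2 e1.
  by rewrite scalerDl (mulC m e2).
by rewrite !(mulDl, mulDr, mulZl, mulZr) !scalerDr !scalerA !addrA.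
Qed.

Lemma cubic_fundamental m v :
  vsval (omega e) (mul m v v) v = (cubic e m).@[fun i => coord e i v].
Proof.
rewrite /omega wedgeE !lfunE /= cubicE /cA /cB /cC /cD /sc_a /sc_b /sc_c /sc_d /sc_e /sc_f.
rewrite -/e1 -/e2.
move: (coord e 0 v) (coord e 1 v) (coord2 v) => x y ->.
rewrite mul2 !linearD !linearZ /= /GRing.scale /= /fq; ring.
Qed.

Lemma invs_act g m : inGL g -> invs e (act g m) = wscale (lfdet g) (invs e m).
Proof.
move=> gi.
set p := coord e 0 ((g^-1)%VF e1); set r := coord e 1 ((g^-1)%VF e1).
set s := coord e 0 ((g^-1)%VF e2); set t := coord e 1 ((g^-1)%VF e2).
pose d := p * t - r * s.
have h1 : (g^-1)%VF e1 = p *: e1 + r *: e2 by apply: coord2.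
have h2 : (g^-1)%VF e2 = s *: e1 + t *: e2 by apply: coord2.
have dE : lfdet (g^-1)%VF = d.
  rewrite (lfdet_basis _ eb) (expand_det_row _ 0) !big_ord_recl big_ord0 /cofactor.
  rewrite !det_mx11 !mxE /= -/e1.
  rewrite (_ : e`_(fintype.bump 0 0) = e2) //.
  rewrite (_ : lift 0 0 = 1 :> 'I_2); last exact/val_inj.
  rewrite (_ : lift 1 0 = 0 :> 'I_2); last exact/val_inj.
  rewrite -/p -/r -/s -/t /d /=; ring.
have gd : lfdet g * d = 1 by rewrite -dE -lfdetM lker0_compfV // lfdet1.
have d0 : d != 0 by apply: contra_eq_neq gd => ->; rewrite mulr0 eq_sym oner_eq0.
have gE : lfdet g = d^-1 by rewrite -[LHS]mulr1 -(mulfV d0) mulrA gd mul1r.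
have cP u v : coord e 0 u = coord e 0 v -> coord e 1 u = coord e 1 v -> u = v.
  by move=> E0 E1; rewrite (coord2 u) (coord2 v) E0 E1.
have g1 : g e1 = d^-1 *: (t *: e1 - r *: e2).
  apply: (can_inj (lker0_lfunVK gi)); rewrite lker0_lfunK //.
  rewrite linearZ linearB !linearZ /= h1 h2.
  by apply: cP; rewrite !(linearD, linearN, linearZ) /= ?c00 ?c01 ?c10 ?c11 /d;
    field; move: d0; rewrite /d.
have g2 : g e2 = d^-1 *: (- s *: e1 + p *: e2).
  apply: (can_inj (lker0_lfunVK gi)); rewrite lker0_lfunK //.
  rewrite linearZ linearD !linearZ /= h1 h2.
  by apply: cP; rewrite !(linearD, linearN, linearZ) /= ?c00 ?c01 ?c10 ?c11 /d;
    field; move: d0; rewrite /d.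
have cg0 x y : coord e 0 (g (x *: e1 + y *: e2)) = d^-1 * (t * x - s * y).
  rewrite linearD !linearZ /= g1 g2 !(linearD, linearN, linearZ) /= c00 c01 /GRing.scale /=.
  ring.
have cg1 x y : coord e 1 (g (x *: e1 + y *: e2)) = d^-1 * (p * y - r * x).
  rewrite linearD !linearZ /= g1 g2 !(linearD, linearN, linearZ) /= c10 c11 /GRing.scale /=.
  ring.
have E11 : mul m e1 e1 = sc_a e m *: e1 + sc_b e m *: e2 by apply: coord2.
have E12 : mul m e1 e2 = sc_e e m *: e1 + sc_f e m *: e2 by apply: coord2.
have E22 : mul m e2 e2 = sc_c e m *: e1 + sc_d e m *: e2 by apply: coord2.
have mE x y z w : mul m (x *: e1 + y *: e2) (z *: e1 + w *: e2) =
    ((x * z) * sc_a e m + (x * w + y * z) * sc_e e m + (y * w) * sc_c e m) *: e1 +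
    ((x * z) * sc_b e m + (x * w + y * z) * sc_f e m + (y * w) * sc_d e m) *: e2.
  rewrite mul2 E11 E12 E22.
  by apply: cP; rewrite !(linearD, linearZ) /= ?c00 ?c01 ?c10 ?c11 /GRing.scale /=; ring.
have Ea : sc_a e (act g m) = d^-1 * (t * (p * p * sc_a e m + (p * r + r * p) * sc_e e m + r * r * sc_c e m)
    - s * (p * p * sc_b e m + (p * r + r * p) * sc_f e m + r * r * sc_d e m)).
  by rewrite {1}/sc_a actE -/e1 h1 mE cg0.
have Eb : sc_b e (act g m) = d^-1 * (p * (p * p * sc_b e m + (p * r + r * p) * sc_f e m + r * r * sc_d e m)
    - r * (p * p * sc_a e m + (p * r + r * p) * sc_e e m + r * r * sc_c e m)).
  by rewrite {1}/sc_b actE -/e1 h1 mE cg1.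
have Ec : sc_c e (act g m) = d^-1 * (t * (s * s * sc_a e m + (s * t + t * s) * sc_e e m + t * t * sc_c e m)
    - s * (s * s * sc_b e m + (s * t + t * s) * sc_f e m + t * t * sc_d e m)).
  by rewrite {1}/sc_c actE -/e2 h2 mE cg0.
have Ed : sc_d e (act g m) = d^-1 * (p * (s * s * sc_b e m + (s * t + t * s) * sc_f e m + t * t * sc_d e m)
    - r * (s * s * sc_a e m + (s * t + t * s) * sc_e e m + t * t * sc_c e m)).
  by rewrite {1}/sc_d actE -/e2 h2 mE cg1.
have Ee : sc_e e (act g m) = d^-1 * (t * (p * s * sc_a e m + (p * t + r * s) * sc_e e m + r * t * sc_c e m)
    - s * (p * s * sc_b e m + (p * t + r * s) * sc_f e m + r * t * sc_d e m)).
  by rewrite {1}/sc_e actE -/e1 -/e2 h1 h2 mE cg0.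
have Ef : sc_f e (act g m) = d^-1 * (p * (p * s * sc_b e m + (p * t + r * s) * sc_f e m + r * t * sc_d e m)
    - r * (p * s * sc_a e m + (p * t + r * s) * sc_e e m + r * t * sc_c e m)).
  by rewrite {1}/sc_f actE -/e1 -/e2 h1 h2 mE cg1.
move: {cg0 cg1 mE E11 E12 E22 g1 g2 h1 h2 dE gd} Ea Eb Ec Ed Ee Ef => Ea Eb Ec Ed Ee Ef.
pose A := cA e m; pose B := cB e m; pose C := cC e m; pose D := cD e m.
pose x := tau e m 0; pose y := tau e m 1.
have EA : cA e (act g m) = d^-1 * fq A B C D p r.
  by rewrite /A /B /C /D /cA /cB /cC /cD Eb /fq; ring.
have EB : cB e (act g m) = d^-1 * (3%:R * A * p ^+ 2 * s + B * (p ^+ 2 * t + 2%:R * p * r * s)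
   + C * (2%:R * p * r * t + r ^+ 2 * s) + 3%:R * D * r ^+ 2 * t).
  by rewrite /A /B /C /D /cA /cB /cC /cD Ea Ef; ring.
have EC : cC e (act g m) = d^-1 * (3%:R * A * p * s ^+ 2 + B * (s ^+ 2 * r + 2%:R * p * s * t)
   + C * (2%:R * r * s * t + t ^+ 2 * p) + 3%:R * D * r * t ^+ 2).
  by rewrite /A /B /C /D /cA /cB /cC /cD Ed Ee; ring.
have ED : cD e (act g m) = d^-1 * fq A B C D s t.
  by rewrite /A /B /C /D /cA /cB /cC /cD Ec /fq; ring.
have Ex : tau e (act g m) 0 = t * x - s * y.
  rewrite /x /y /tau !(tnth_nth 0) /= Ed Ee /d; field; exact: d0.
have Ey : tau e (act g m) 1 = p * y - r * x.
  rewrite /x /y /tau !(tnth_nth 0) /= Ea Ef /d; field; exact: d0.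
rewrite /invs /p3 /p2 /disc /Inv /wscale !scalerA gE !cubicE !hessE !jacobE EA EB EC ED Ex Ey.
rewrite -/A -/B -/C -/D -/x -/y.
have hq k A1 B1 C1 D1 x1 y1 : fq (k * A1) (k * B1) (k * C1) (k * D1) x1 y1 = k * fq A1 B1 C1 D1 x1 y1.
  by rewrite /fq; ring.
have hh k A1 B1 C1 D1 x1 y1 : fh (k * A1) (k * B1) (k * C1) (k * D1) x1 y1 = k ^+ 2 * fh A1 B1 C1 D1 x1 y1.
  by rewrite /fh; ring.
have hj k A1 B1 C1 D1 x1 y1 : fj (k * A1) (k * B1) (k * C1) (k * D1) x1 y1 = k ^+ 3 * fj A1 B1 C1 D1 x1 y1.
  by rewrite /fj; ring.
have hd k A1 B1 C1 D1 : fd (k * A1) (k * B1) (k * C1) (k * D1) = k ^+ 4 * fd A1 B1 C1 D1.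
  by rewrite /fd; ring.
rewrite hq hh hj -/(fd _ _ _ _) hd -/(fd A B C D) fq_cov fh_cov fj_cov fd_cov -/d.
have [w1 w2 w3 w4] := weights (fq A B C D x y) (fh A B C D x y) (fd A B C D)
  (fj A B C D x y) 54%:R^-1 d0.
by rewrite w1 w2 w3 w4.
Qed.

Local Open Scope quotient_scope.

Lemma zeta_s_pi m : zeta_s e (\pi_(calg_SL V) m) = invs e m.
Proof.
rewrite /zeta_s; case: piP => m' /eqmodP/asboolP[g [gi g1] ->].
by rewrite invs_act // g1 wscale1.
Qed.

Lemma zeta_g_pi m : zeta_g e (\pi_(calg_GL V) m) = \pi_(wproj V) (invs e m).
Proof.
rewrite /zeta_g; case: piP => m' /eqmodP/asboolP[g gi ->].
apply/esym/eqmodP/asboolP; exists (lfdet g); last by rewrite invs_act.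
apply/eqP => g0; have := lfdetM g (g^-1)%VF.
by rewrite g0 mul0r lker0_compfV // lfdet1 => /eqP; rewrite oner_eq0.
Qed.

Lemma dim_lline : 2%N \notin [pchar F] -> \dim {:lline V} = 1%N.
Proof.
move=> F2; have two0 : 2%:R != 0 :> F by apply: contra F2 => h; rewrite inE /= h.
have alt (B : lline V) v : vsval B v v = 0.
  have /antisymvP/(_ v v)/eqP := subvsP B.
  by rewrite -addr_eq0 -mulr2n -scaler_nat scaler_eq0 (negPf two0) => /eqP.
suff -> : fullv = <[omega e]>%VS.
  rewrite dim_vline; suff -> : omega e != 0 by [].
  apply/eqP => /(congr1 (fun B : lline V => vsval B e1 e2)).
  rewrite /omega wedgeE !lfunE /= c00 c11 c01 c10 mulr1 mulr0 subr0.
  by move/eqP; rewrite oner_eq0.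
apply/eqP; rewrite eqEsubv subvf andbT; apply/subvP => B _.
apply/vlineP; exists (vsval B e1 e2); apply/val_inj/lfunP => v; apply/lfunP => w.
rewrite linearZ /= !scale_lfunE /omega wedgeE !lfunE /=.
have asym u u' : vsval B u u' = - vsval B u' u by apply/antisymvP/subvsP.
rewrite {1}(coord2 v) linearD !linearZ /= add_lfunE !scale_lfunE.
rewrite {1 2}(coord2 w) !(linearD, linearZ) /= !alt (asym e2 e1) /GRing.scale /=; ring.
Qed.

End InvariantsTheory.

Section Psi.
Variables (F : fieldType) (V : vectType F).

(* The scalar c such that A = c *: D, for vectors A and D != 0 of a line. *)
Definition ldiv (W : vectType F) (A D : W) : F := coord [tuple D] 0 A.

(* Only used on classes with D != 0; see Psi3_pi for the value. *)
Definition Psi3 (x : wproj V) : F * F :=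
  let: (A, B, D, C) := repr x : lquad V in (ldiv A D, ldiv B D).

Definition Psi3t (x : wproj V) : rays (lpow V 2 * lpow V 2 * lpow V 2)%type :=
  let: (A, B, D, C) := repr x : lquad V in
  \pi_(rays (lpow V 2 * lpow V 2 * lpow V 2)%type)%qT (A, B, D).

Lemma dim_Hom (U W : vectType F) : \dim {:'Hom(U, W)} = (\dim {:U} * \dim {:W})%N.
Proof. by rewrite !dimvf. Qed.

Lemma dim_lpow (e : 2.-tuple V) r :
  2%N \notin [pchar F] -> basis_of {:V} e -> \dim {:lpow V r} = 1%N.
Proof.
move=> F2 eb; elim: r => [|r IH] /=; first by rewrite dimvf.
by rewrite !dim_Hom IH (dim_lline eb F2) dimvf.
Qed.

Lemma ldivE (W : vectType F) (A D : W) : \dim {:W} = 1%N -> D != 0 -> A = ldiv A D *: D.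
Proof.
move=> W1 D0; have b : basis_of {:W} [tuple D].
  rewrite basisEdim /= W1 andbT; apply/subvP => v _.
  suff -> : <<[:: D]>>%VS = {:W}%VS by rewrite memvf.
  by apply/eqP; rewrite eqEdim subvf W1 span_seq1 dim_vline D0.
by rewrite {1}(coord_basis b (memvf A)) big_ord_recl big_ord0 addr0.
Qed.

Lemma ldivZ (W : vectType F) (c : F) (D : W) : \dim {:W} = 1%N -> D != 0 -> ldiv (c *: D) D = c.
Proof.
move=> W1 D0; apply/eqP; rewrite -subr_eq0; have /eqP := ldivE (c *: D) W1 D0.
by rewrite eq_sym -subr_eq0 -scalerBl scaler_eq0 (negPf D0) orbF.
Qed.

Lemma Psi3_pi (e : 2.-tuple V) (A B D : lpow V 2) (C : lpow V 3) :
  2%N \notin [pchar F] -> basis_of {:V} e -> D != 0 ->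
  Psi3 (\pi_(wproj V)%qT (A, B, D, C)) = (ldiv A D, ldiv B D).
Proof.
move=> F2 eb D0; have W1 := dim_lpow 2 F2 eb.
rewrite /Psi3; case: piP => -[[[A' B'] D'] C'] /eqmodP/asboolP[k k0 [-> -> -> _]].
have kD0 : k ^- 2 *: D != 0 by rewrite scaler_eq0 negb_or D0 invr_eq0 expf_neq0.
have E X : ldiv (k ^- 2 *: X) (k ^- 2 *: D) = ldiv X D.
  by rewrite {1}(ldivE X W1 D0) scalerA mulrC -scalerA ldivZ.
by rewrite !E.
Qed.

Lemma Psi3t_pi (A B D : lpow V 2) (C : lpow V 3) :
  Psi3t (\pi_(wproj V)%qT (A, B, D, C)) =
  \pi_(rays (lpow V 2 * lpow V 2 * lpow V 2)%type)%qT (A, B, D).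
Proof.
rewrite /Psi3t; case: piP => -[[[A' B'] D'] C'] /eqmodP/asboolP[k k0 [-> -> -> _]].
apply/esym/eqmodP/asboolP; exists (k ^- 2) => //.
by rewrite invr_eq0 expf_neq0.
Qed.
End Psi.

(* Main.v *)
Require Import Defs.
From mathcomp Require Import all_boot all_order all_algebra.
From mathcomp Require Import boolp classical_sets functions.
From mathcomp Require Import mpoly ring.
Import GRing.Theory.

(** When 3 is invertible, an algebra [m] is the same thing as a pair (q, v): the binary
cubic q of its fundamental cubic, and the vector v = [tau m].  The group SL acts on such
pairs by linear substitution, and the four invariants are q(v), mu(v), Disc q and G(v).
Writing alpha, beta, delta, gamma for them, the defining equation of the Eisenstein set
is the classical syzygy 432 delta alpha^2 + beta^3 + gamma^2 = 0 between the covariants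
of a binary cubic ([cinvs_syzygy], [syzygy_cinvs]).

The heart of the proof is a normal form that depends on the invariants alone
([normal_formP], [cinvs_normal_form]).  If v is nonzero it can be moved to (1, 0), and a
shear fixing v then kills one coefficient of q: the coefficient of x^2 y when alpha is
nonzero, and that of x y^2 when alpha = 0 and beta is nonzero.  In both cases the
invariants determine the remaining coefficients.  If alpha = beta = 0 and delta is
nonzero, then v = 0 and q has three distinct roots; moving one of them to (1, 0),
rescaling and shearing gives q = x^2 y - (delta / 4) y^3.  Hence two algebras with the
same nonzero invariants lie in one SL-orbit ([invs_SLorb]), and every point of the
Eisenstein set is attained ([invs_surj]).

Stable algebras are exactly those whose invariants are not all zero ([stable_invs]).  If
the invariants do not vanish, one of alpha, beta, delta is a quartic invariant which is
nonzero on the algebra.  If they all vanish, the pair can be moved to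
q = C x y^2 + D y^3 and v = (x, 0), where a one-parameter subgroup contracts it to zero,
so every homogeneous invariant of positive degree vanishes there.

Since the determinant of g acts on the invariants by weighted scaling, the statements on
GL-orbits follow from those on SL-orbits.  For the last two maps, the syzygy determines C
up to sign from (A, B, D), and scaling by -1 changes that sign ([Eisenstein_worb]);
surjectivity only needs a square root. *)

Set Implicit Arguments.
Unset Strict Implicit.
Unset Printing Implicit Defensive.

Local Open Scope classical_set_scope.
Local Open Scope quotient_scope.
Local Open Scope ring_scope.

Local Notation mul := Defs.mul.
Local Notation Inv := Defs.Inv.
(* A binary cubic A x^3 + B x^2 y + C x y^2 + D y^3 with a vector (x, y). *)
Local Notation vcubic F := (F * F * F * F * F * F)%type.
Local Notation SLorb := (Defs.orb (@inSL _ _)).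

(** * Algebras as pairs of a binary cubic and a vector *)

Lemma prime_natr_neq0 {F : fieldType} n : prime n -> n \notin [pchar F] -> n%:R != 0 :> F.
Proof. by move=> n_prime; apply: contra => h; rewrite inE n_prime. Qed.

Section Coordinates.
Variables (F : fieldType) (V : vectType F) (e : 2.-tuple V).
Hypothesis e_basis : basis_of {:V} e.
Implicit Types m : calg V.

(** The pair (q, v) of the fundamental cubic and the vector [tau m], in coordinates. *)
Definition coefs m : vcubic F :=
  (cA e m, cB e m, cC e m, cD e m, tau e m 0, tau e m 1).

(** For a substitution of determinant 1: the cubic q(p X + s Y, r X + t Y), together with
the coordinates of the vector (x, y) in the basis (p, r), (s, t). *)
Definition csubst (p r s t : F) (u : vcubic F) :=
  let: (A, B, C, D, x, y) := u in
  (fq A B C D p r,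
   3%:R * A * p ^+ 2 * s + B * (p ^+ 2 * t + 2%:R * p * r * s)
     + C * (2%:R * p * r * t + r ^+ 2 * s) + 3%:R * D * r ^+ 2 * t,
   3%:R * A * p * s ^+ 2 + B * (s ^+ 2 * r + 2%:R * p * s * t)
     + C * (2%:R * r * s * t + t ^+ 2 * p) + 3%:R * D * r * t ^+ 2,
   fq A B C D s t, t * x - s * y, p * y - r * x).

Lemma tau0 m : tau e m 0 = sc_d e m + sc_e e m.
Proof. by rewrite /tau (tnth_nth 0). Qed.

Lemma tau1 m : tau e m 1 = - (sc_a e m + sc_f e m).
Proof. by rewrite /tau (tnth_nth 0). Qed.

Lemma coord_e (i j : 'I_2) : coord e i e`_j = (i == j)%:R.
Proof. by rewrite (coord_free j i (basis_free e_basis)) eq_sym. Qed.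

Lemma coord_comb0 x y : coord e 0 (x *: e`_0 + y *: e`_1) = x.
Proof.
by rewrite linearD !linearZ /= (coord_e 0 0) (coord_e 0 1) /GRing.scale /= mulr1 mulr0 addr0.
Qed.

Lemma coord_comb1 x y : coord e 1 (x *: e`_0 + y *: e`_1) = y.
Proof.
by rewrite linearD !linearZ /= (coord_e 1 0) (coord_e 1 1) /GRing.scale /= mulr1 mulr0 add0r.
Qed.

Lemma coordP (i : 'I_2) k u v : coord e i (k *: u + v) = k * coord e i u + coord e i v.
Proof. by rewrite linearP. Qed.

Lemma coord_inj u v : coord e 0 u = coord e 0 v -> coord e 1 u = coord e 1 v -> u = v.
Proof. by move=> E0 E1; rewrite (coord2 e_basis u) (coord2 e_basis v) E0 E1. Qed.

(** The endomorphism sending the basis to p e_0 + r e_1 and s e_0 + t e_1. *)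
Definition lcomb (p r s t : F) (v : V) : V :=
  (p * coord e 0 v + s * coord e 1 v) *: e`_0 + (r * coord e 0 v + t * coord e 1 v) *: e`_1.

Lemma lcomb_linear p r s t : linear (lcomb p r s t).
Proof.
move=> k u v; apply: coord_inj; rewrite [RHS]coordP /lcomb !(coord_comb0, coord_comb1) !coordP;
  ring.
Qed.

Lemma lcombM p r s t p' r' s' t' v :
  lcomb p r s t (lcomb p' r' s' t' v) =
  lcomb (p * p' + s * r') (r * p' + t * r') (p * s' + s * t') (r * s' + t * t') v.
Proof.
rewrite {1}/lcomb coord_comb0 coord_comb1 /lcomb.
by congr (_ *: _ + _ *: _); ring.
Qed.

Lemma lcomb_basis0 p r s t : lcomb p r s t e`_0 = p *: e`_0 + r *: e`_1.
Proof. by rewrite /lcomb (coord_e 0 0) (coord_e 1 0) !mulr1 !mulr0 !addr0. Qed.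

Lemma lcomb_basis1 p r s t : lcomb p r s t e`_1 = s *: e`_0 + t *: e`_1.
Proof. by rewrite /lcomb (coord_e 0 1) (coord_e 1 1) !mulr1 !mulr0 !add0r. Qed.

Lemma lcomb1 v : lcomb 1 0 0 1 v = v.
Proof. by rewrite /lcomb !mul1r !mul0r addr0 add0r -coord2. Qed.

(** The substitution with matrix p, r, s, t is the action of the element g whose inverse,
and not g itself, has that matrix: the action on bilinear maps uses g^-1 in the
arguments. *)
Lemma exists_inGL p r s t : p * t - r * s != 0 ->
  exists g : 'End(V), [/\ inGL g, (g^-1)%VF =1 lcomb p r s t,
    g =1 lcomb (t / (p * t - r * s)) (- r / (p * t - r * s))
               (- s / (p * t - r * s)) (p / (p * t - r * s))
    & lfdet g = (p * t - r * s)^-1].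
Proof.
set d := p * t - r * s => d0.
pose g := linfun (lcomb (t / d) (- r / d) (- s / d) (p / d)).
have gE : g =1 lcomb (t / d) (- r / d) (- s / d) (p / d).
  exact: linfun_lin (lcomb_linear _ _ _ _).
have Kg v : lcomb p r s t (g v) = v.
  rewrite gE lcombM -[RHS]lcomb1.
  by congr (lcomb _ _ _ _ v); rewrite /d; field.
have gK : inGL g by apply/lker0P/(can_inj Kg).
exists g; split=> // [v|].
  by rewrite -{2}[v](lker0_lfunVK gK) Kg.
rewrite (lfdet_basis _ e_basis) (expand_det_row _ 0) !big_ord_recl big_ord0 /cofactor.
rewrite !det_mx11 !mxE /= !gE.
rewrite (_ : fintype.bump 0 0 = 1%N) //.
rewrite (_ : lift 0 0 = 1 :> 'I_2); last exact/val_inj.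
rewrite (_ : lift 1 0 = 0 :> 'I_2); last exact/val_inj.
rewrite lcomb_basis0 lcomb_basis1 !coord_comb0 !coord_comb1 /= /d; field.
exact: d0.
Qed.

Lemma exists_lfdet k : k != 0 -> exists2 g : 'End(V), inGL g & lfdet g = k.
Proof.
move=> k0; have d0 : k^-1 * 1 - 0 * 0 != 0 by rewrite mulr1 mulr0 subr0 invr_eq0.
have [g [gG _ _ gd]] := exists_inGL d0.
by exists g; rewrite // gd mulr1 mulr0 subr0 invrK.
Qed.

Lemma calg_eq m m' :
  mul m e`_0 e`_0 = mul m' e`_0 e`_0 -> mul m e`_0 e`_1 = mul m' e`_0 e`_1 ->
  mul m e`_1 e`_1 = mul m' e`_1 e`_1 -> m = m'.
Proof.
move=> E00 E01 E11; apply/calgP => v w.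
by rewrite (coord2 e_basis v) (coord2 e_basis w) !mul2 E00 E01 E11.
Qed.

Lemma sc_inj m m' :
  sc_a e m = sc_a e m' -> sc_b e m = sc_b e m' -> sc_c e m = sc_c e m' ->
  sc_d e m = sc_d e m' -> sc_e e m = sc_e e m' -> sc_f e m = sc_f e m' -> m = m'.
Proof.
rewrite /sc_a /sc_b /sc_c /sc_d /sc_e /sc_f => Ea Eb Ec Ed Ee Ef.
by apply: calg_eq; apply: coord_inj.
Qed.

(** Symmetry is the only constraint on the six structure constants. *)
Lemma exists_sc a b c d k f : exists m,
  [/\ sc_a e m = a, sc_b e m = b, sc_c e m = c & [/\ sc_d e m = d, sc_e e m = k & sc_f e m = f]].
Proof.
pose h v w :=
  (a * (coord e 0 v * coord e 0 w) + k * (coord e 0 v * coord e 1 w + coord e 1 v * coord e 0 w)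
     + c * (coord e 1 v * coord e 1 w)) *: e`_0 +
  (b * (coord e 0 v * coord e 0 w) + f * (coord e 0 v * coord e 1 w + coord e 1 v * coord e 0 w)
     + d * (coord e 1 v * coord e 1 w)) *: e`_1.
have hC v w : h v w = h w v by rewrite /h; congr (_ *: _ + _ *: _); ring.
have hl v : linear (h v).
  move=> z x y; apply: coord_inj; rewrite [RHS]coordP /h !(coord_comb0, coord_comb1) !coordP;
  ring.
have hE v w : bilfun h v w = h v w.
  by apply: bilfunE => // u z x y; rewrite ![h _ u]hC hl.
pose m : calg V := vsproj (symv V V) (bilfun h).
have mE v w : mul m v w = h v w.
  by rewrite /mul /m vsprojK ?hE //; apply/symvP => ? ?; rewrite !hE.
exists m; rewrite /sc_a /sc_b /sc_c /sc_d /sc_e /sc_f !mE /h.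
rewrite !(coord_e 0 0, coord_e 0 1, coord_e 1 0, coord_e 1 1) /=.
by rewrite !(coord_comb0, coord_comb1) !(mulr0, mulr1, mul0r, addr0, add0r).
Qed.

Lemma sc_basis m : [/\ mul m e`_0 e`_0 = sc_a e m *: e`_0 + sc_b e m *: e`_1,
  mul m e`_0 e`_1 = sc_e e m *: e`_0 + sc_f e m *: e`_1
  & mul m e`_1 e`_1 = sc_c e m *: e`_0 + sc_d e m *: e`_1].
Proof. by split; apply: coord2. Qed.

Lemma mul_comb m x y z w :
  mul m (x *: e`_0 + y *: e`_1) (z *: e`_0 + w *: e`_1) =
  ((x * z) * sc_a e m + (x * w + y * z) * sc_e e m + (y * w) * sc_c e m) *: e`_0 +
  ((x * z) * sc_b e m + (x * w + y * z) * sc_f e m + (y * w) * sc_d e m) *: e`_1.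
Proof.
rewrite mul2; have [-> -> ->] := sc_basis m.
by rewrite !scalerDr !scalerA [X in X + _ = _]addrACA [LHS]addrACA -!scalerDl.
Qed.

(** Transport of structure: [csubst] was defined so that it is the action of SL read on
the pairs (q, v). *)
Lemma coefs_act p r s t : p * t - r * s = 1 ->
  exists2 g : 'End(V), inSL g & forall m, coefs (act g m) = csubst p r s t (coefs m).
Proof.
move=> d1; have d0 : p * t - r * s != 0 by rewrite d1 oner_eq0.
have [g [gG gV gE gd]] := exists_inGL d0.
rewrite !d1 !divr1 invr1 in gE gd.
exists g => [|m]; first by [].
have {}gE x y : g (x *: e`_0 + y *: e`_1) = (t * x - s * y) *: e`_0 + (p * y - r * x) *: e`_1.
  by rewrite gE /lcomb coord_comb0 coord_comb1; congr (_ *: _ + _ *: _); ring.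
have mE v w : mul (act g m) v w = g (mul m (lcomb p r s t v) (lcomb p r s t w)).
  by rewrite actE !gV.
(* The computation of the vector of [act g m] yields an extra factor p t - r s. *)
have detM k : k = (p * t - r * s) * k by rewrite d1 mul1r.
rewrite /coefs !tau0 !tau1 /cA /cB /cC /cD /csubst.
rewrite [t * _ - s * _]detM [p * (- _) - _]detM.
rewrite -[sc_a e (act g m)]/(coord e 0 (mul (act g m) e`_0 e`_0)).
rewrite -[sc_b e (act g m)]/(coord e 1 (mul (act g m) e`_0 e`_0)).
rewrite -[sc_c e (act g m)]/(coord e 0 (mul (act g m) e`_1 e`_1)).
rewrite -[sc_d e (act g m)]/(coord e 1 (mul (act g m) e`_1 e`_1)).
rewrite -[sc_e e (act g m)]/(coord e 0 (mul (act g m) e`_0 e`_1)).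
rewrite -[sc_f e (act g m)]/(coord e 1 (mul (act g m) e`_0 e`_1)).
rewrite !mE lcomb_basis0 lcomb_basis1 !mul_comb !gE !coord_comb0 !coord_comb1 /fq.
by congr (_, _, _, _, _, _); ring.
Qed.

(** The equations a - 2 f = B, a + f = - y and 2 e - d = C, d + e = x form two linear
systems of determinant 3. *)
Lemma coefs_inj m m' : 3%N \notin [pchar F] -> coefs m = coefs m' -> m = m'.
Proof.
move=> /(prime_natr_neq0 (isT : prime 3)) F3.
rewrite /coefs !tau0 !tau1 /cA /cB /cC /cD => -[Eb Eaf Eed Ec Ede Eaf'].
have cancel3 (u v : F) : 3%:R * u = 3%:R * v -> u = v by apply: mulfI.
have af k : 3%:R * sc_a e k = sc_a e k - 2%:R * sc_f e k - 2%:R * (- (sc_a e k + sc_f e k)) by ring.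
have fa k : 3%:R * sc_f e k = - (sc_a e k - 2%:R * sc_f e k) - (- (sc_a e k + sc_f e k)) by ring.
have de k : 3%:R * sc_d e k = 2%:R * (sc_d e k + sc_e e k) - (2%:R * sc_e e k - sc_d e k) by ring.
have ed k : 3%:R * sc_e e k = (sc_d e k + sc_e e k) + (2%:R * sc_e e k - sc_d e k) by ring.
apply: sc_inj => //.
all: try exact: oppr_inj Eb.
all: try (by apply: cancel3; rewrite ?af ?fa ?de ?ed; congruence).
Qed.

Lemma coefs_surj u : 3%N \notin [pchar F] -> exists m, coefs m = u.
Proof.
move=> /(prime_natr_neq0 (isT : prime 3)) F3; case: u => [[[[[A B] C] D] x] y].
have [m [Ea Eb Ec [Ed Ee Ef]]] := exists_sc ((B - 2%:R * y) / 3%:R) (- A) D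
  ((2%:R * x - C) / 3%:R) ((x + C) / 3%:R) (- (y + B) / 3%:R).
exists m; rewrite /coefs !tau0 !tau1 /cA /cB /cC /cD Ea Eb Ec Ed Ee Ef.
by congr (_, _, _, _, _, _); field.
Qed.

Lemma SLorb_csubst p r s t m : p * t - r * s = 1 ->
  exists2 m', SLorb m m' & coefs m' = csubst p r s t (coefs m).
Proof.
by move=> /coefs_act[g gS gE]; exists (act g m) => //; apply/asboolP; exists g.
Qed.

Lemma invs_coefs m : invs e m =
  let: (A, B, C, D, x, y) := coefs m in
  (- 8%:R * fq A B C D x y *: tpow 2 (omega e), fh A B C D x y *: tpow 2 (omega e),
   fd A B C D *: tpow 2 (omega e), 54%:R^-1 * fj A B C D x y *: tpow 3 (omega e)).
Proof. by rewrite /invs /p3 /p2 /disc /Inv cubicE hessE jacobE. Qed.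
End Coordinates.

(** * The action of SL on cubics with a vector *)

Section Substitutions.
Variable F : fieldType.
Implicit Types (A B C D x y : F) (u : vcubic F).

Definition cinvs u : F * F * F * F :=
  let: (A, B, C, D, x, y) := u in
  (fq A B C D x y, fh A B C D x y, fd A B C D, fj A B C D x y).

Lemma cinvs_csubst p r s t u : p * t - r * s = 1 -> cinvs (csubst p r s t u) = cinvs u.
Proof.
case: u => [[[[[A B] C] D] x] y] d1.
by rewrite /cinvs /csubst fq_cov fh_cov fj_cov fd_cov d1 !expr1n !mul1r.
Qed.

(** The classical syzygy between a binary cubic, its Hessian and its Jacobian covariant. *)
Lemma cinvs_syzygy A B C D x y :
  432%:R * fd A B C D * fq A B C D x y ^+ 2 + fh A B C D x y ^+ 3 + fj A B C D x y ^+ 2 = 0.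
Proof. rewrite /fd /fq /fh /fj; ring. Qed.

Lemma csubstM p r s t p' r' s' t' u :
  csubst p' r' s' t' (csubst p r s t u) =
  csubst (p * p' + s * r') (r * p' + t * r') (p * s' + s * t') (r * s' + t * t') u.
Proof.
case: u => [[[[[A B] C] D] x] y].
by rewrite /csubst /fq; congr (_, _, _, _, _, _); ring.
Qed.

Definition SL_equiv u u' := exists p r s t, p * t - r * s = 1 /\ u' = csubst p r s t u.

Lemma SL_equiv_trans u1 u2 u3 : SL_equiv u1 u2 -> SL_equiv u2 u3 -> SL_equiv u1 u3.
Proof.
move=> [p [r [s [t [d1 ->]]]]] [p' [r' [s' [t' [d1' ->]]]]].
rewrite csubstM; do 4!eexists; split; last reflexivity.
by rewrite -[RHS]mulr1 -{1}d1 -d1'; ring.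
Qed.

Lemma cinvs_equiv u u' : SL_equiv u u' -> cinvs u' = cinvs u.
Proof. by move=> [p [r [s [t [d1 ->]]]]]; apply: cinvs_csubst. Qed.

(** Shears along (1, 0) fix the vectors on that line, so they can be used to simplify the
cubic once the vector has been normalized. *)
Lemma SL_equiv_shear s A B C D x :
  SL_equiv (A, B, C, D, x, 0)
    (A, 3%:R * A * s + B, 3%:R * A * s ^+ 2 + 2%:R * B * s + C, fq A B C D s 1, x, 0).
Proof.
exists 1, 0, s, 1; split; first by rewrite mul1r mul0r subr0.
by rewrite /csubst /fq; congr (_, _, _, _, _, _); ring.
Qed.

Lemma SL_equiv_diag k A B C D x y : k != 0 ->
  SL_equiv (A, B, C, D, x, y) (k ^+ 3 * A, k * B, k^-1 * C, k^-1 ^+ 3 * D, k^-1 * x, k * y).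
Proof.
move=> k0; exists k, 0, 0, k^-1; split; first by rewrite mulfV // mul0r subr0.
by rewrite /csubst /fq; congr (_, _, _, _, _, _); field.
Qed.

(** SL acts transitively on nonzero vectors: complete (x, y) to a basis of determinant 1. *)
Lemma SL_equiv_vector A B C D x y : (x != 0) || (y != 0) ->
  exists A' B' C' D', SL_equiv (A, B, C, D, x, y) (A', B', C', D', 1, 0).
Proof.
move=> xy0; have [s [t d1]] : exists s t, x * t - y * s = 1.
  have [x0|x0] := eqVneq x 0.
    move: xy0; rewrite x0 eqxx /= => y0.
    by exists (- y^-1), 0; rewrite mulr0 mulrN mulfV // sub0r opprK.
  by exists 0, x^-1; rewrite mulfV // mulr0 subr0.
exists (fq A B C D x y); do 3!eexists; exists x, y, s, t; split=> //.
rewrite /csubst; congr (_, _, _, _, _, _); last by ring.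
by rewrite -d1; ring.
Qed.

(** Moving the root (p, 1) of the cubic to (1, 0) kills the coefficient of x^3. *)
Lemma SL_equiv_root A B C D p : fq A B C D p 1 = 0 ->
  SL_equiv (A, B, C, D, 0, 0)
    (0, - (3%:R * A * p ^+ 2 + 2%:R * B * p + C), 3%:R * A * p + B, - A, 0, 0).
Proof.
move=> qp0; exists p, 1, (- 1), 0; split; first by ring.
by rewrite /csubst qp0 /fq; congr (_, _, _, _, _, _); ring.
Qed.
End Substitutions.

(** * Normal forms and the null cone *)

Section NormalForms.
Variable F : closedFieldType.
Hypotheses (char2 : 2%N \notin [pchar F]) (char3 : 3%N \notin [pchar F]).

Let F2 : 2%:R != 0 :> F. Proof. exact: prime_natr_neq0 char2. Qed.
Let F3 : 3%:R != 0 :> F. Proof. exact: prime_natr_neq0 char3. Qed.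

Lemma exists_sqrt (a : F) : exists b, b ^+ 2 = a.
Proof.
have [b bE] := @solve_monicpoly F 2 (fun i => if i == 0%N then a else 0) isT.
by exists b; rewrite bE !big_ord_recl big_ord0 /= expr0 mulr1 mul0r !addr0.
Qed.

Lemma SL_equiv_root0 (A B C D : F) :
  exists B' C' D', SL_equiv (A, B, C, D, 0, 0) (0, B', C', D', 0, 0).
Proof.
have [->|A0] := eqVneq A 0.
  exists B, C, D; exists 1, 0, 0, 1; split; first by ring.
  by rewrite /csubst /fq; congr (_, _, _, _, _, _); ring.
have [p pE] := @solve_monicpoly F 3 (fun i => - nth 0 [:: D; C; B] i / A) isT.
have qp0 : fq A B C D p 1 = 0.
  by rewrite /fq pE !big_ord_recl big_ord0 /= /fintype.bump /=; field.
by do 3!eexists; apply: SL_equiv_root qp0.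
Qed.

(** The representative of the orbit with the given invariants.  The entries come from
solving for the coefficients at v = (1, 0): if B = 0 then mu(v) = 12 A C and
G(v) = 108 A^2 D; if A = C = 0 then mu(v) = - 4 B^2, G(v) = 8 B^3 and
Disc = - 4 B^3 D, so that B = - gamma / (2 beta). *)
Definition normal_form (alpha beta delta gamma : F) : vcubic F :=
  if alpha != 0 then
    (alpha, 0, beta / (12%:R * alpha), gamma / (108%:R * alpha ^+ 2), 1, 0)
  else if beta != 0 then (0, - gamma / (2%:R * beta), 0, - 2%:R * delta / gamma, 1, 0)
  else (0, 1, 0, - delta / 4%:R, 0, 0).

Let F4 : 4%:R != 0 :> F.
Proof. by rewrite (_ : 4%:R = 2%:R * 2%:R :> F) ?mulf_neq0 //; ring. Qed.

Let F8 : 8%:R != 0 :> F.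
Proof. by rewrite (_ : 8%:R = 4%:R * 2%:R :> F) ?mulf_neq0 //; ring. Qed.

Let F12 : 12%:R != 0 :> F.
Proof. by rewrite (_ : 12%:R = 2%:R * 2%:R * 3%:R :> F) ?mulf_neq0 //; ring. Qed.

Let F108 : 108%:R != 0 :> F.
Proof. by rewrite (_ : 108%:R = 12%:R * 3%:R * 3%:R :> F) ?mulf_neq0 //; ring. Qed.

(** Each transformation used preserves the invariants, so after the geometric
normalization the surviving coefficients are read off from them.  A zero vector singles
out no direction; a root of the cubic is used instead. *)
Lemma normal_formP (u : vcubic F) alpha beta delta gamma :
  cinvs u = (alpha, beta, delta, gamma) ->
  [|| alpha != 0, beta != 0 | delta != 0] -> SL_equiv u (normal_form alpha beta delta gamma).
Proof.
case: u => [[[[[A B] C] D] x] y] uE nz; rewrite /normal_form.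
have [xy0|] := boolP ((x != 0) || (y != 0)); last first.
  rewrite negb_or !negbK => /andP[/eqP x0 /eqP y0]; subst x y.
  move: uE nz; rewrite /cinvs => -[<- <- dE _].
  rewrite (_ : fq _ _ _ _ _ _ = 0) /fq; last by ring.
  rewrite (_ : fh _ _ _ _ _ _ = 0) /fh; last by ring.
  rewrite eqxx /= => d0.
  have [B' [C' [D' e1]]] := SL_equiv_root0 A B C D.
  apply: (SL_equiv_trans e1).
  have {dE} : fd 0 B' C' D' = delta.
    by move/cinvs_equiv: e1; rewrite /cinvs => -[_ _ -> _].
  have [-> dE|B0 dE] := eqVneq B' 0.
    by move: d0; rewrite -dE /fd (_ : _ - _ = 0) ?eqxx //; ring.
  (* The torus makes the coefficient of x^2 y equal to 1; the shear then removes x y^2. *)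
  have k0 : B'^-1 != 0 by rewrite invr_eq0.
  apply: (SL_equiv_trans (SL_equiv_diag 0 B' C' D' 0 0 k0)).
  rewrite !mulr0 mulVf // invrK.
  have := SL_equiv_shear (- (B' * C') / 2%:R) 0 1 (B' * C') (B' ^+ 3 * D') 0.
  congr SL_equiv; rewrite -dE /fq /fd; congr (_, _, _, _, _, _);
    by [ring | field; rewrite ?F4 ?F2].
have [A' [B' [C' [D' e1]]]] := SL_equiv_vector A B C D xy0.
have := cinvs_equiv e1; rewrite uE /cinvs => -[qE hE dE jE].
apply: (SL_equiv_trans e1).
have qE' : A' = alpha by rewrite -qE /fq; ring.
have [al0|al0] := eqVneq alpha 0; rewrite /=.
  rewrite {}qE' {}al0 in qE hE dE jE nz *.
  have {}hE : beta = - 4%:R * B' ^+ 2 by rewrite -hE /fh; ring.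
  have {}jE : gamma = 8%:R * B' ^+ 3 by rewrite -jE /fj; ring.
  have [be0|be0] /= := eqVneq beta 0.
    move: be0 dE nz; rewrite hE eqxx => /eqP.
    rewrite mulf_eq0 oppr_eq0 expf_eq0 /= => /orP[F40|/eqP ->].
      by move: F4; rewrite F40.
    by rewrite /fd => <-; rewrite (_ : _ - _ = 0) ?eqxx ?orbT //; ring.
  have B0 : B' != 0 by apply: contraNneq be0 => B0; rewrite hE B0 expr0n mulr0.
  have := SL_equiv_shear (- C' / (2%:R * B')) 0 B' C' D' 1.
  congr SL_equiv; rewrite hE jE -dE /fq /fd; congr (_, _, _, _, _, _);
    by [ring | field; rewrite ?oppr_eq0 ?F2 ?F4 ?F8 ?B0].
have := SL_equiv_shear (- B' / (3%:R * A')) A' B' C' D' 1.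
congr SL_equiv; rewrite -qE' -hE -jE /fq /fh /fj.
have A0 : A' != 0 by rewrite qE'.
congr (_, _, _, _, _, _);
  by [ring | field; rewrite ?F3 ?A0 ?F12 ?F108].
Qed.

Let F432 : 432%:R != 0 :> F.
Proof. by rewrite (_ : 432%:R = 108%:R * 4%:R :> F) ?mulf_neq0 //; ring. Qed.

(** The syzygy supplies the one invariant that is not free: delta if alpha is nonzero, and
otherwise the relation gamma^2 = - beta^3 that makes B = - gamma / (2 beta) a solution of
both - 4 B^2 = beta and 8 B^3 = gamma. *)
Lemma cinvs_normal_form (alpha beta delta gamma : F) :
  432%:R * delta * alpha ^+ 2 + beta ^+ 3 + gamma ^+ 2 = 0 ->
  [|| alpha != 0, beta != 0 | delta != 0] ->
  cinvs (normal_form alpha beta delta gamma) = (alpha, beta, delta, gamma).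
Proof.
move=> syz nz; rewrite /normal_form /cinvs.
have g2 : gamma ^+ 2 = - (432%:R * delta * alpha ^+ 2 + beta ^+ 3).
  by apply/eqP; rewrite -addr_eq0 addrC syz.
have [al0|al0] /= := eqVneq alpha 0; last first.
  have deltaE : delta = - (beta ^+ 3 + gamma ^+ 2) / (432%:R * alpha ^+ 2).
    by rewrite g2; field; rewrite al0 F432.
  rewrite deltaE /fq /fh /fd /fj; congr (_, _, _, _);
    by [ring | field; rewrite ?al0 ?F12 ?F108 ?F432].
have {}g2 : gamma ^+ 2 = - beta ^+ 3 by rewrite g2 al0; ring.
have [be0|be0] /= := eqVneq beta 0.
  have -> : gamma = 0 by apply/eqP; rewrite -sqrf_eq0 g2 be0 expr0n oppr0.
  rewrite al0 be0 /fq /fh /fd /fj; congr (_, _, _, _); by [ring | field; rewrite ?F4].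
have ga0 : gamma != 0 by rewrite -sqrf_eq0 g2 oppr_eq0 expf_neq0.
have betaE : - gamma ^+ 2 / beta ^+ 2 = beta by rewrite g2; field.
have gammaE : - gamma ^+ 3 / beta ^+ 3 = gamma.
  by rewrite exprS g2; field.
have deltaE : - gamma ^+ 2 / beta ^+ 3 * delta = delta by rewrite g2; field.
rewrite al0 /fq /fh /fd /fj; congr (_, _, _, _); first by ring.
- by rewrite -[RHS]betaE; field; rewrite be0 ga0 F2.
- by rewrite -[RHS]deltaE; field; rewrite be0 ga0 F2.
by rewrite -[RHS]gammaE; field; rewrite be0 ga0 F2.
Qed.

(** If v is nonzero, move it to (1, 0): then A = q(v) and - 4 B^2 = mu(v) both vanish.  If
v = 0, the vanishing discriminant gives a nonzero q a double root, which is moved to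
(1, 0). *)
Lemma SL_equiv_null (u : vcubic F) : cinvs u = (0, 0, 0, 0) ->
  exists C D x, SL_equiv u (0, 0, C, D, x, 0).
Proof.
case: u => [[[[[A B] C] D] x] y] uE.
have [xy0|] := boolP ((x != 0) || (y != 0)).
  have [A' [B' [C' [D' e1]]]] := SL_equiv_vector A B C D xy0.
  have := cinvs_equiv e1; rewrite uE /cinvs => -[qE hE _ _].
  have A0 : A' = 0 by rewrite -qE /fq; ring.
  have B0 : B' = 0.
    apply/eqP; rewrite -sqrf_eq0 -(mulrI_eq0 _ (mulfI F4)) -oppr_eq0 -hE A0 /fh.
    by apply/eqP; ring.
  by exists C', D', 1; rewrite A0 B0 in e1.
rewrite negb_or !negbK => /andP[/eqP x0 /eqP y0]; subst x y.
have [B' [C' [D' e1]]] := SL_equiv_root0 A B C D.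
have [B0|B0] := eqVneq B' 0.
  by exists C', D', 0; rewrite B0 in e1.
have := cinvs_equiv e1; rewrite uE /cinvs => -[_ _ dE _].
have {}dE : C' ^+ 2 = 4%:R * B' * D'.
  apply/eqP; rewrite -subr_eq0 -(mulrI_eq0 _ (mulfI (expf_neq0 2 B0))) -dE /fd.
  by apply/eqP; ring.
(* With A' = 0 the cubic is B' y (x + C' / (2 B') y)^2; this is its double root. *)
pose p := - C' / (2%:R * B').
have qp0 : fq 0 B' C' D' p 1 = 0.
  rewrite (_ : fq _ _ _ _ _ _ = (4%:R * B' * D' - C' ^+ 2) / (4%:R * B')).
    by rewrite dE subrr mul0r.
  by rewrite /fq /p; field; rewrite ?F2 ?F4 ?B0.
have e2 := SL_equiv_root qp0.
exists (3%:R * 0 * p + B'), (- 0), 0.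
apply: (SL_equiv_trans e1); move: e2; congr SL_equiv.
by congr (_, _, _, _, _, _); rewrite /p; field; rewrite ?F2 ?B0.
Qed.
End NormalForms.

(** * Coordinates on the powers of L *)

Section Powers.
Variables (F : fieldType) (V : vectType F).

Lemma tmulZr r s (x : lpow V r) (y : lpow V s) k : tmul x (k *: y) = k *: tmul x y.
Proof.
elim: r x => [|r IH] x /=; first by rewrite !scalerA mulrC.
apply/lfunP => phi; rewrite scale_lfunE !linfun_lin ?IH // => a f g; rewrite linearP; exact: tmulDl.
Qed.

Lemma tpow_neq0 r (x : lline V) : x != 0 -> tpow r x != 0.
Proof.
move=> x0; elim: r => [|r IH] /=; first exact: oner_neq0.
have x_free : free [tuple x] by rewrite /= seq1_free.
apply: contraNneq IH => t0.
have /eqP := congr1 (fun t : lpow V r.+1 => t (linfun (coord [tuple x] 0 : _ -> F^o))) t0.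
by rewrite /= tconsE lfunE /= (coord_free 0 0 x_free) scale1r lfunE.
Qed.

Variable e : 2.-tuple V.
Hypotheses (char2 : 2%N \notin [pchar F]) (e_basis : basis_of {:V} e).

Lemma omega_neq0 : omega e != 0.
Proof.
apply/eqP => /(congr1 (fun B : lline V => vsval B e`_0 e`_1)).
rewrite /omega wedgeE !lfunE /= (coord_e e_basis 0 0) (coord_e e_basis 1 1)
  (coord_e e_basis 1 0) /= mulr1 mul0r subr0.
by move/eqP; rewrite oner_eq0.
Qed.

Lemma tpow_omega_inj r : injective (fun c => c *: tpow r (omega e)).
Proof.
move=> a b /eqP; rewrite -subr_eq0 -scalerBl scaler_eq0 subr_eq0.
by rewrite (negPf (tpow_neq0 r omega_neq0)) orbF => /eqP.
Qed.

Lemma lpow_coord r (z : lpow V r) : exists c, z = c *: tpow r (omega e).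
Proof.
exists (ldiv z (tpow r (omega e))).
by apply: ldivE; [apply: dim_lpow e_basis | apply: tpow_neq0 omega_neq0].
Qed.

Definition lquad_of (a b d c : F) : lquad V :=
  (a *: tpow 2 (omega e), b *: tpow 2 (omega e), d *: tpow 2 (omega e), c *: tpow 3 (omega e)).

Lemma lquad_coord (x : lquad V) : exists a b d c, x = lquad_of a b d c.
Proof.
case: x => [[[A B] D] C].
have [[a ->] [b ->]] := (lpow_coord A, lpow_coord B).
by have [[d ->] [c ->]] := (lpow_coord D, lpow_coord C); exists a, b, d, c.
Qed.

Lemma lquad_of_inj a b d c a' b' d' c' :
  lquad_of a b d c = lquad_of a' b' d' c' -> [/\ a = a', b = b', d = d' & c = c'].
Proof.
by case=> /tpow_omega_inj-> /tpow_omega_inj-> /tpow_omega_inj-> /tpow_omega_inj->.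
Qed.

Lemma scale_tpow_eq0 r c : (c *: tpow r (omega e) == 0) = (c == 0).
Proof. by rewrite scaler_eq0 (negPf (tpow_neq0 r omega_neq0)) orbF. Qed.

Lemma syzygy_coords a b d c :
  syzygy (a *: tpow 2 (omega e)) (b *: tpow 2 (omega e)) (d *: tpow 2 (omega e))
    (c *: tpow 3 (omega e)) = 0 <->
  27%:R * d * a ^+ 2 + 4%:R * b ^+ 3 + 2%:R ^+ 4 * 3%:R ^+ 6 * c ^+ 2 = 0.
Proof.
rewrite /syzygy !(tmulZl, tmulZr) !tmul_tpow !scalerA -!scalerDl.
rewrite (_ : 27%:R * d * a * a + _ + _ = 27%:R * d * a ^+ 2 + 4%:R * b ^+ 3
  + 2%:R ^+ 4 * 3%:R ^+ 6 * c ^+ 2); last by ring.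
by split=> [/eqP|->]; [rewrite scale_tpow_eq0 => /eqP | rewrite scale0r].
Qed.
End Powers.

(** * Polynomial functions and stability *)

Section PolynomialFunctions.
Variables (F : fieldType) (W : vectType F).

Definition homog_fun d (f : W -> F) :=
  exists2 p : {mpoly F[\dim {:W}]}, p \is d.-homog & forall w, polyfun p w = f w.

Lemma homog_funD d f g : homog_fun d f -> homog_fun d g -> homog_fun d (fun w => f w + g w).
Proof.
move=> [p ph pE] [q qh qE]; exists (p + q); first exact: rpredD.
by move=> w; rewrite -pE -qE /polyfun mevalD.
Qed.

Lemma homog_funZ d k f : homog_fun d f -> homog_fun d (fun w => k * f w).
Proof.
move=> [p ph pE]; exists (k *: p); first exact: rpredZ.
by move=> w; rewrite -pE /polyfun mevalZ.
Qed.

Lemma homog_funM d d' f g :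
  homog_fun d f -> homog_fun d' g -> homog_fun (d + d') (fun w => f w * g w).
Proof.
move=> [p ph pE] [q qh qE]; exists (p * q); first exact: dhomogM.
by move=> w; rewrite -pE -qE /polyfun mevalM.
Qed.

Lemma homog_fun_eq d f g : f =1 g -> homog_fun d f -> homog_fun d g.
Proof. by move=> fg [p ph pE]; exists p => // w; rewrite pE fg. Qed.

Lemma homog_fun_linear f : (forall k u v, f (k *: u + v) = k * f u + f v) -> homog_fun 1 f.
Proof.
move=> fP; exists (\sum_(i < \dim {:W}) f (vbasis {:W})`_i *: 'X_i).
  by apply: rpred_sum => i _; apply: rpredZ; rewrite dhomogX /= mdeg1.
have f0 : f 0 = 0.
  have /eqP := fP 1 0 0; rewrite scale1r addr0 mul1r.
  by rewrite -subr_eq0 opprD addrA subrr sub0r oppr_eq0 => /eqP.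
have fsum (h : 'I_(\dim {:W}) -> W) : f (\sum_i h i) = \sum_i f (h i).
  by apply: (big_morph f) => // u v; rewrite -[u]scale1r fP mul1r scale1r.
move=> w; rewrite {2}(coord_basis (vbasisP {:W}) (memvf w)) fsum /polyfun raddf_sum.
apply: eq_bigr => i _; rewrite /= mevalZ mevalXU mulrC.
by rewrite -[_ *: _ in RHS]addr0 fP f0 addr0.
Qed.

Lemma homog_fun4 k f g h l :
  homog_fun 1 f -> homog_fun 1 g -> homog_fun 1 h -> homog_fun 1 l ->
  homog_fun 4 (fun w => k * (f w * g w * (h w * l w))).
Proof.
by move=> hf hg hh hl; apply/homog_funZ/(homog_funM (homog_funM hf hg) (homog_funM hh hl)).
Qed.

(** A one-parameter subgroup of SL moves a null pair along such a curve. *)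
Lemma polyfun_curve (p : {mpoly F[\dim {:W}]}) (k l : nat) (u v : W) :
  exists P : {poly F}, forall t, P.[t] = polyfun p (t ^+ k *: u + t ^+ l *: v).
Proof.
pose h i := coord (vbasis {:W}) i u *: 'X^k + coord (vbasis {:W}) i v *: 'X^l.
exists (mmap polyC h p) => t.
rewrite /polyfun mevalE /mmap horner_sum; apply: eq_bigr => mm _.
rewrite hornerM hornerC /mmap1 horner_prod; congr (_ * _); apply: eq_bigr => i _.
by rewrite horner_exp /h hornerD !hornerZ !hornerXn linearD !linearZ /= ![_ * t ^+ _]mulrC.
Qed.

Lemma polyfun0 d (p : {mpoly F[\dim {:W}]}) : (0 < d)%N -> p \is d.-homog -> polyfun p 0 = 0.
Proof.
move=> d0 ph; rewrite /polyfun mevalE big_seq big1 // => mm /(dhomog_mf ph) /= mmd.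
have [i mi0] : exists i, mm i != 0%N.
  apply/existsP; apply: contraTT d0; rewrite -mmd negb_exists => /forallP mm0.
  by rewrite mdegE big1 // => i _; apply/eqP; rewrite -[_ == _]negbK.
by rewrite (bigD1 i) //= linear0 expr0n (negPf mi0) mul0r mulr0.
Qed.
End PolynomialFunctions.

(** If c differed from P(0), the polynomial X (P - c) + 1 would be nonconstant without
roots: it takes the value 1 everywhere. *)
Lemma poly_const_units (F : closedFieldType) (P : {poly F}) c :
  (forall t, t != 0 -> P.[t] = c) -> P.[0] = c.
Proof.
move=> Pc; apply/eqP; rewrite -subr_eq0; apply: contraT => P0.
pose Q := 'X * (P - c%:P) + 1.
have /closed_rootP[t] : size Q != 1.
  have QP : P - c%:P != 0.
    by apply: contraNneq P0 => /(congr1 (horner^~ 0)); rewrite !hornerE => ->.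
  have sz : (1 < size ('X * (P - c%:P))%R)%N.
    by rewrite mulrC size_mulX // ltnS lt0n size_poly_eq0.
  by rewrite /Q size_polyDl ?size_poly1 // neq_ltn sz orbT.
rewrite /root /Q !hornerE; have [->|t0] := eqVneq t 0; first by rewrite mul0r add0r oner_eq0.
by rewrite Pc // subrr mulr0 add0r oner_eq0.
Qed.

Section Stability.
Variables (F : closedFieldType) (V : vectType F) (e : 2.-tuple V).
Hypotheses (char2 : 2%N \notin [pchar F]) (char3 : 3%N \notin [pchar F]).
Hypothesis e_basis : basis_of {:V} e.
Implicit Types m : calg V.

Lemma coefs_linear k m m' :
  [/\ cA e (k *: m + m') = k * cA e m + cA e m',
      cB e (k *: m + m') = k * cB e m + cB e m',
      cC e (k *: m + m') = k * cC e m + cC e m',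
      cD e (k *: m + m') = k * cD e m + cD e m' &
      forall i, tau e (k *: m + m') i = k * tau e m i + tau e m' i].
Proof.
have mulP v w : mul (k *: m + m') v w = k *: mul m v w + mul m' v w.
  by rewrite /mul linearP /= add_lfunE scale_lfunE add_lfunE scale_lfunE.
have cE i v w : coord e i (mul (k *: m + m') v w) =
    k * coord e i (mul m v w) + coord e i (mul m' v w) by rewrite mulP coordP.
rewrite /cA /cB /cC /cD /sc_a /sc_b /sc_c /sc_d /sc_e /sc_f !cE.
split; try ring; case=> -[|[|//]] lti.
  by rewrite (_ : Ordinal lti = 0); [rewrite !tau0 /sc_d /sc_e !cE; ring | apply/val_inj].
by rewrite (_ : Ordinal lti = 1); [rewrite !tau1 /sc_a /sc_f !cE; ring | apply/val_inj].
Qed.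

Let hA : homog_fun 1 (cA e).
Proof. by apply: homog_fun_linear => k m m'; case: (coefs_linear k m m'). Qed.
Let hB : homog_fun 1 (cB e).
Proof. by apply: homog_fun_linear => k m m'; case: (coefs_linear k m m'). Qed.
Let hC : homog_fun 1 (cC e).
Proof. by apply: homog_fun_linear => k m m'; case: (coefs_linear k m m'). Qed.
Let hD : homog_fun 1 (cD e).
Proof. by apply: homog_fun_linear => k m m'; case: (coefs_linear k m m'). Qed.
Let ht i : homog_fun 1 (tau e ^~ i).
Proof. by apply: homog_fun_linear => k m m'; case: (coefs_linear k m m'). Qed.

Let homog_fq : homog_fun 4
  (fun m => fq (cA e m) (cB e m) (cC e m) (cD e m) (tau e m 0) (tau e m 1)).
Proof.
have [hx hy] := (ht 0, ht 1).
apply: homog_fun_eq (homog_funD (homog_funD (homog_fun4 1 hA hx hx hx) (homog_fun4 1 hB hx hx hy))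
  (homog_funD (homog_fun4 1 hC hx hy hy) (homog_fun4 1 hD hy hy hy))) => m; rewrite /fq; ring.
Qed.

Let homog_fh : homog_fun 4
  (fun m => fh (cA e m) (cB e m) (cC e m) (cD e m) (tau e m 0) (tau e m 1)).
Proof.
have [hx hy] := (ht 0, ht 1).
apply: homog_fun_eq (homog_funD (homog_funD
    (homog_funD (homog_fun4 12%:R hA hC hx hx) (homog_fun4 (- 4%:R) hB hB hx hx))
    (homog_funD (homog_fun4 36%:R hA hD hx hy) (homog_fun4 (- 4%:R) hB hC hx hy)))
  (homog_funD (homog_fun4 12%:R hB hD hy hy) (homog_fun4 (- 4%:R) hC hC hy hy))) => m.
rewrite /fh; ring.
Qed.

Let homog_fd : homog_fun 4 (fun m => fd (cA e m) (cB e m) (cC e m) (cD e m)).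
Proof.
apply: homog_fun_eq (homog_funD (homog_funD
    (homog_funD (homog_fun4 18%:R hA hB hC hD) (homog_fun4 1 hB hB hC hC))
    (homog_funD (homog_fun4 (- 4%:R) hA hC hC hC) (homog_fun4 (- 4%:R) hB hB hB hD)))
  (homog_fun4 (- 27%:R) hA hA hD hD)) => m.
rewrite /fd; ring.
Qed.

Let F2 : 2%:R != 0 :> F. Proof. exact: prime_natr_neq0 char2. Qed.
Let F3 : 3%:R != 0 :> F. Proof. exact: prime_natr_neq0 char3. Qed.

Lemma eight_neq0 : - 8%:R != 0 :> F.
Proof. by rewrite (_ : - 8%:R = - (2%:R * 2%:R * 2%:R) :> F) ?oppr_eq0 ?mulf_neq0 //; ring. Qed.

Lemma fiftyfour_neq0 : 54%:R != 0 :> F.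
Proof. by rewrite (_ : 54%:R = 2%:R * 3%:R * 3%:R * 3%:R :> F) ?mulf_neq0 //; ring. Qed.

Lemma invs_coords m alpha beta delta gamma : cinvs (coefs e m) = (alpha, beta, delta, gamma) <->
  invs e m = lquad_of e (- 8%:R * alpha) beta delta (54%:R^-1 * gamma).
Proof.
rewrite invs_coefs; case: (coefs e m) => [[[[[A B] C] D] x] y] /=; split.
  by rewrite /cinvs => -[-> -> -> ->].
case/(lquad_of_inj e_basis) => /(mulfI eight_neq0)-> -> ->.
have i54 : 54%:R^-1 != 0 :> F by rewrite invr_eq0 fiftyfour_neq0.
by move=> /(mulfI i54)->.
Qed.

Lemma cinvs_act g m : inSL g -> cinvs (coefs e (act g m)) = cinvs (coefs e m).
Proof.
case=> gG gd; case E: (cinvs (coefs e m)) => [[[alpha beta] delta] gamma].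
by apply/invs_coords; rewrite (invs_act e_basis) // gd wscale1; apply/invs_coords.
Qed.

Lemma SL_equiv_orb m u :
  SL_equiv (coefs e m) u -> exists2 m', SLorb m m' & coefs e m' = u.
Proof. by move=> [p [r [s [t [d1 ->]]]]]; apply: SLorb_csubst. Qed.

Lemma cinvs_neq0 m alpha beta delta gamma : cinvs (coefs e m) = (alpha, beta, delta, gamma) ->
  invs e m != 0 -> [|| alpha != 0, beta != 0 | delta != 0].
Proof.
move=> E; have /invs_coords -> := E; apply: contraNT.
rewrite !negb_or !negbK => /and3P[/eqP al0 /eqP be0 /eqP de0].
suff -> : gamma = 0 by rewrite al0 be0 de0 !mulr0 /lquad_of !scale0r.
have := cinvs_syzygy (cA e m) (cB e m) (cC e m) (cD e m) (tau e m 0) (tau e m 1).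
move: E; rewrite /cinvs /= => -[-> -> -> ->].
rewrite al0 be0 !expr0n !mulr0 !add0r => /eqP.
by rewrite sqrf_eq0 => /eqP.
Qed.

(** The Hilbert-Mumford argument.  On the null pair (0, 0, C, D, x, 0) the diagonal
subgroup acts with the positive weights 1, 3 and 1 only, so its orbit is a curve
t u + t^3 v whose closure contains 0; an invariant is constant along it, equal to its value
at 0. *)
Lemma stable_invs m : @stable F V m <-> invs e m != 0.
Proof.
case E: (cinvs (coefs e m)) => [[[alpha beta] delta] gamma].
have /invs_coords mE := E; split.
  case=> d [p [d0 ph pI pm]]; apply: contraNneq pm => m0.
  have E0 : cinvs (coefs e m) = (0, 0, 0, 0).
    by apply/invs_coords; rewrite m0 !mulr0 /lquad_of !scale0r.
  have [C [D [x e1]]] := SL_equiv_null char2 E0.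
  have [m1 /asboolP[g gS m1E] c1] := SL_equiv_orb e1.
  have [[u uE] [v vE]] := (coefs_surj e_basis (0, 0, C, 0, x, 0) char3,
    coefs_surj e_basis (0, 0, 0, D, 0, 0) char3).
  have [P PE] := polyfun_curve p 1 3 u v.
  have := @poly_const_units _ P (polyfun p m).
  rewrite !PE expr1 expr0n /= !scale0r addr0 (polyfun0 d0 ph) => <- // t t0.
  rewrite PE.
  have t0' : t^-1 != 0 by rewrite invr_eq0.
  have := SL_equiv_diag 0 0 C D x 0 t0'; rewrite -{1}c1 => /SL_equiv_orb[m2 /asboolP[h hS m2E] c2].
  have -> : t ^+ 1 *: u + t ^+ 3 *: v = m2.
    apply: (coefs_inj e_basis char3); rewrite c2 !mulr0 invrK.
    move: uE vE; rewrite /coefs => -[uA uB uC uD ux uy] [vA vB vC vD vx vy].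
    have [-> -> -> -> tauD] := coefs_linear (t ^+ 1) u (t ^+ 3 *: v).
    have := coefs_linear (t ^+ 3 - 1) v v; rewrite scalerBl scale1r subrK => -[-> -> -> -> tauZ].
    rewrite !tauD !tauZ uA uB uC uD ux uy vA vB vC vD vx vy.
    by congr (_, _, _, _, _, _); ring.
  by rewrite m2E pI // m1E pI.
move=> m0.
have nz := cinvs_neq0 E m0.
have stab (f : calg V -> F) : homog_fun 4 f -> f m != 0 ->
    (forall g m', inSL g -> f (act g m') = f m') -> stable m.
  move=> [p ph pE] fm fI; exists 4, p; split=> // [g m' gS|]; rewrite !pE //.
  exact: fI.
move: E nz; rewrite /cinvs /= => -[<- <- <- _].
case/or3P => nz.
- by apply: (stab _ homog_fq nz) => g m' /cinvs_act; rewrite /cinvs /= => /(_ m')[].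
- by apply: (stab _ homog_fh nz) => g m' /cinvs_act; rewrite /cinvs /= => /(_ m')[].
- by apply: (stab _ homog_fd nz) => g m' /cinvs_act; rewrite /cinvs /= => /(_ m')[].
Qed.
End Stability.

(** * Orbits and points of the Eisenstein set *)

Section Classification.
Variables (F : closedFieldType) (V : vectType F) (e : 2.-tuple V).
Hypotheses (char2 : 2%N \notin [pchar F]) (char3 : 3%N \notin [pchar F]).
Hypothesis e_basis : basis_of {:V} e.
Implicit Types (m : calg V) (S : set (lquad V)).

(** The factors - 8 and 1 / 54 in the definition of the invariants turn the classical
syzygy into the equation of the Eisenstein set, up to the factor 4. *)
Lemma syzygy_cinvs (alpha beta delta gamma : F) :
  27%:R * delta * (- 8%:R * alpha) ^+ 2 + 4%:R * beta ^+ 3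
    + 2%:R ^+ 4 * 3%:R ^+ 6 * (54%:R^-1 * gamma) ^+ 2 =
  4%:R * (432%:R * delta * alpha ^+ 2 + beta ^+ 3 + gamma ^+ 2).
Proof. by field; rewrite fiftyfour_neq0. Qed.

Lemma invs_Eisenstein m : invs e m != 0 -> @Eisenstein F V (invs e m).
Proof.
move=> m0; split=> //.
rewrite /invs; apply/(syzygy_coords e_basis).
rewrite cubicE hessE jacobE.
by rewrite -/(fd _ _ _ _) syzygy_cinvs cinvs_syzygy mulr0.
Qed.

Lemma invs_surj x : @Eisenstein F V x -> exists m, invs e m = x.
Proof.
have [a [b [d [c ->]]]] := lquad_coord char2 e_basis x.
case=> x0 /(syzygy_coords e_basis) syz.
have F8 := eight_neq0 char2; have F54 := fiftyfour_neq0 char2 char3.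
pose alpha := a / - 8%:R; pose gamma := 54%:R * c.
have aE : a = - 8%:R * alpha by rewrite mulrC divfK.
have cE : c = 54%:R^-1 * gamma by rewrite mulKf.
have F4 : 4%:R != 0 :> F.
  by rewrite (_ : 4%:R = 2%:R * 2%:R :> F) ?mulf_neq0 ?(prime_natr_neq0 _ char2) //; ring.
have {}syz : 432%:R * d * alpha ^+ 2 + b ^+ 3 + gamma ^+ 2 = 0.
  by apply: (mulfI F4); rewrite mulr0 -syzygy_cinvs -aE -cE.
have nz : [|| alpha != 0, b != 0 | d != 0].
  apply: contraNT x0; rewrite !negb_or !negbK => /and3P[/eqP al0 /eqP be0 /eqP de0].
  move: syz; rewrite al0 be0 de0 !expr0n !mulr0 !add0r => /eqP.
  by rewrite sqrf_eq0 cE aE al0 => /eqP ->; rewrite !mulr0 /lquad_of !scale0r.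
have [m mE] := coefs_surj e_basis (normal_form alpha b d gamma) char3.
exists m; rewrite aE cE; apply/invs_coords => //.
by rewrite mE cinvs_normal_form.
Qed.

Lemma invs_SLorb m m' : invs e m != 0 -> invs e m = invs e m' -> SLorb m m'.
Proof.
move=> m0 mm'; case E: (cinvs (coefs e m)) => [[[alpha beta] delta] gamma].
have E' : cinvs (coefs e m') = (alpha, beta, delta, gamma).
  by apply/(invs_coords char2 char3 e_basis); rewrite -mm'; apply/(invs_coords char2 char3 e_basis).
have nz := cinvs_neq0 char2 char3 e_basis E m0.
have [m1 o1 c1] := SL_equiv_orb e_basis (normal_formP char2 char3 E nz).
have [m2 o2 c2] := SL_equiv_orb e_basis (normal_formP char2 char3 E' nz).
have m12 : m1 = m2 by apply: (coefs_inj e_basis char3); rewrite c1 c2.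
by apply: (SLorb_trans o1); rewrite SLorb_sym m12.
Qed.

Lemma Eisenstein_neq0 S m : S `<=` @Eisenstein F V -> S (invs e m) -> invs e m != 0.
Proof. by move=> SE /SE[]. Qed.

(** Covers both the stable and the generic algebras, which are the preimages of two
subsets of the Eisenstein set. *)
Lemma zeta_s_bij S : S `<=` @Eisenstein F V ->
  set_bij (\pi_(calg_SL V) @` [set m | S (invs e m)]) S (zeta_s e).
Proof.
move=> SE; split.
- by move=> _ [m Sm <-]; rewrite zeta_s_pi.
- move=> _ _ /set_mem[m Sm <-] /set_mem[m' Sm' <-]; rewrite !(zeta_s_pi e_basis) => mm'.
  apply/eqmodP; exact: invs_SLorb (Eisenstein_neq0 SE Sm) mm'.
- move=> x Sx; have [m mE] := invs_surj (SE _ Sx).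
  by exists (\pi_(calg_SL V) m); [exists m; rewrite /= ?mE | rewrite (zeta_s_pi e_basis)].
Qed.

(** If the invariants of m' are those of m scaled by k, acting on m by an element of
determinant k reduces to the case of equal invariants. *)
Lemma zeta_g_bij S : S `<=` @Eisenstein F V ->
  set_bij (\pi_(calg_GL V) @` [set m | S (invs e m)]) (\pi_(wproj V) @` S) (zeta_g e).
Proof.
move=> SE; split.
- by move=> _ [m Sm <-]; rewrite (zeta_g_pi e_basis); exists (invs e m).
- move=> _ _ /set_mem[m Sm <-] /set_mem[m' Sm' <-]; rewrite !(zeta_g_pi e_basis).
  move=> /eqmodP/asboolP[k k0 mm'].
  have [g gG gd] := exists_lfdet e_basis k0.
  have gm : invs e (act g m) = invs e m' by rewrite mm' -gd; exact: (invs_act e_basis m gG).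
  have /asboolP[h [hG _] hm] : SLorb (act g m) m'.
    apply: (invs_SLorb _ gm); rewrite gm; exact: Eisenstein_neq0 SE Sm'.
  apply/eqmodP/asboolP; exists (h \o g)%VF; first exact: inGLM.
  by rewrite hm actM.
- move=> _ [x Sx <-]; have [m mE] := invs_surj (SE _ Sx).
  by exists (\pi_(calg_GL V) m); [exists m; rewrite /= ?mE | rewrite (zeta_g_pi e_basis) mE].
Qed.

Lemma stableE : @stable F V = [set m | @Eisenstein F V (invs e m)].
Proof.
apply/seteqP; split=> m /=; first by move/(stable_invs char2 char3 e_basis)/invs_Eisenstein.
by case=> m0 _; apply/(stable_invs char2 char3 e_basis).
Qed.

Lemma genericE : generic e = [set m | @Eisenstein_star F V (invs e m)].
Proof.
apply/seteqP; split=> m /=; last by case.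
move=> d0; split=> //; apply: invs_Eisenstein.
by apply: contraNneq d0 => -[_ _ /eqP].
Qed.

Let F16 : 2%:R ^+ 4 * 3%:R ^+ 6 != 0 :> F.
Proof. by rewrite mulf_neq0 ?expf_neq0 ?(prime_natr_neq0 _ char2) ?(prime_natr_neq0 _ char3). Qed.

(** For l^2 = k^-1, scaling by l multiplies A, B, D by k, and both C' and l^-3 C have the
square prescribed by the equation; replacing l by - l corrects the sign. *)
Lemma Eisenstein_worb (A B D : lpow V 2) C k A' B' D' C' :
  k != 0 -> A' = k *: A -> B' = k *: B -> D' = k *: D ->
  @Eisenstein F V (A, B, D, C) -> @Eisenstein F V (A', B', D', C') ->
  Defs.worb (A, B, D, C) (A', B', D', C').
Proof.
move=> k0 -> -> -> [_ syz] [_ syz'].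
have coord2E r := @lpow_coord _ _ _ char2 e_basis r.
have [[[a aE] [b bE]] [[d dE] [c cE]]] := ((coord2E _ A, coord2E _ B), (coord2E _ D, coord2E _ C)).
have [c' cE'] := coord2E _ C'.
rewrite {}aE {}bE {}dE {}cE {}cE' !scalerA in syz syz' *.
move: syz syz' => /(syzygy_coords e_basis) syz /(syzygy_coords e_basis) syz'.
have [l lE] := exists_sqrt k^-1.
have kE : k = l ^- 2 by rewrite lE invrK.
have l0 : l != 0 by apply: contraNneq k0 => l0; rewrite kE l0 expr0n invr0.
have c2 : c' ^+ 2 = (l ^- 3 * c) ^+ 2.
  apply: (mulfI F16).
  have -> : 2%:R ^+ 4 * 3%:R ^+ 6 * c' ^+ 2 =
      - (27%:R * (k * d) * (k * a) ^+ 2 + 4%:R * (k * b) ^+ 3).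
    by apply/eqP; rewrite -addr_eq0 addrC syz'.
  have -> : 2%:R ^+ 4 * 3%:R ^+ 6 * (l ^- 3 * c) ^+ 2 = k ^+ 3 * (2%:R ^+ 4 * 3%:R ^+ 6 * c ^+ 2).
    by rewrite kE; field.
  have -> : 2%:R ^+ 4 * 3%:R ^+ 6 * c ^+ 2 = - (27%:R * d * a ^+ 2 + 4%:R * b ^+ 3).
    by apply/eqP; rewrite -addr_eq0 addrC syz.
  by ring.
have [s [s0 sE s3]] : exists s, [/\ s != 0, s ^- 2 = k & s ^- 3 * c = c'].
  move/eqP: c2; rewrite eqf_sqr => /orP[/eqP->|/eqP->]; [exists l | exists (- l)].
    by split.
  by split; rewrite ?oppr_eq0 // ?sqrrN // exprNn -signr_odd /= expr1 mulN1r invrN mulNr.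
by apply/asboolP; exists s; [exact: s0 | rewrite /wscale sE !scalerA s3].
Qed.

Lemma exists_Eisenstein (A B D : lpow V 2) : (A, B, D) != 0 ->
  exists C, @Eisenstein F V (A, B, D, C).
Proof.
move=> x0.
have [a [b [d [_ [aE bE dE _]]]]] := lquad_coord char2 e_basis (A, B, D, 0).
have [c cE] := exists_sqrt (- (27%:R * d * a ^+ 2 + 4%:R * b ^+ 3) / (2%:R ^+ 4 * 3%:R ^+ 6)).
exists (c *: tpow 3 (omega e)); split.
  by apply: contraNneq x0 => -[-> -> -> _].
rewrite aE bE dE; apply/(syzygy_coords e_basis).
by rewrite cE [_ * (_ / _)]mulrC divfK // subrr.
Qed.

Lemma Eisenstein_ABD_neq0 (A B D : lpow V 2) C : @Eisenstein F V (A, B, D, C) -> (A, B, D) != 0.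
Proof.
case=> x0 syz; apply: contraNneq x0 => -[A0 B0 D0]; rewrite {}A0 {}B0 {}D0 in syz *.
have [c cE] := lpow_coord char2 e_basis C.
move: syz; rewrite cE -(scale0r (tpow 2 (omega e))) => /(syzygy_coords e_basis).
rewrite !expr0n !mulr0 !add0r => /eqP; rewrite mulf_eq0 (negPf F16) sqrf_eq0 => /eqP ->.
by rewrite !scale0r.
Qed.

Lemma Psi3_bij : set_bij (\pi_(wproj V) @` @Eisenstein_star F V) [set: F * F] (@Psi3 F V).
Proof.
have W1 := dim_lpow 2 char2 e_basis.
split=> //.
- move=> _ _ /set_mem[[[[A B] D] C] [EX D0] <-] /set_mem[[[[A' B'] D'] C'] [EX' D0'] <-].
  rewrite !(Psi3_pi _ _ _ char2 e_basis) // => -[EA EB].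
  have k0 : ldiv D' D != 0.
    by apply: contraNneq D0' => k0; rewrite (ldivE D' W1 D0) k0 scale0r.
  apply/eqmodP/(Eisenstein_worb k0 _ _ (ldivE D' W1 D0) EX EX').
    by rewrite (ldivE A' W1 D0') -EA {1}(ldivE D' W1 D0) {2}(ldivE A W1 D0) !scalerA mulrC.
  by rewrite (ldivE B' W1 D0') -EB {1}(ldivE D' W1 D0) {2}(ldivE B W1 D0) !scalerA mulrC.
- move=> [a b] _; pose D := tpow 2 (omega e).
  have D0 : D != 0 := tpow_neq0 2 (omega_neq0 e_basis).
  have [|C EX] := @exists_Eisenstein (a *: D) (b *: D) D.
    by apply: contraNneq D0 => -[_ _ ->].
  exists (\pi_(wproj V) (a *: D, b *: D, D, C)); first by exists (a *: D, b *: D, D, C).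
  by rewrite (Psi3_pi _ _ _ char2 e_basis) // !ldivZ.
Qed.

Lemma Psi3t_bij : set_bij (\pi_(wproj V) @` @Eisenstein F V)
  (@proj_space F (lpow V 2 * lpow V 2 * lpow V 2)%type) (@Psi3t F V).
Proof.
split.
- move=> _ [[[[A B] D] C] EX <-]; rewrite Psi3t_pi; exists (A, B, D) => //.
  exact: Eisenstein_ABD_neq0 EX.
- move=> _ _ /set_mem[[[[A B] D] C] EX <-] /set_mem[[[[A' B'] D'] C'] EX' <-].
  rewrite !Psi3t_pi => /eqmodP/asboolP[k k0 [EA EB ED]].
  exact/eqmodP/(Eisenstein_worb k0 EA EB ED EX EX').
- move=> _ [[[A B] D] x0 <-]; have [C EX] := exists_Eisenstein x0.
  by exists (\pi_(wproj V) (A, B, D, C)); [exists (A, B, D, C) | rewrite Psi3t_pi].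
Qed.
End Classification.

Theorem theorem7p8 (F : closedFieldType)
    (char2 : 2%N \notin [pchar F]) (char3 : 3%N \notin [pchar F])
    (V : vectType F) (dimV : \dim {:V} = 2%N)
    (e : 2.-tuple V) (e_basis : basis_of {:V} e) :
  set_bij (\pi_(calg_SL V) @` generic e) (@Eisenstein_star F V) (zeta_s e) /\
  set_bij (\pi_(calg_GL V) @` generic e)
    (\pi_(wproj V) @` @Eisenstein_star F V) (zeta_g e) /\
  set_bij (\pi_(calg_SL V) @` @stable F V) (@Eisenstein F V) (zeta_s e) /\
  set_bij (\pi_(calg_GL V) @` @stable F V)
    (\pi_(wproj V) @` @Eisenstein F V) (zeta_g e) /\
  set_bij (\pi_(wproj V) @` @Eisenstein_star F V) [set: F * F] (@Psi3 F V) /\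
  set_bij (\pi_(wproj V) @` @Eisenstein F V)
    (@proj_space F (lpow V 2 * lpow V 2 * lpow V 2)%type) (@Psi3t F V).
Proof.
have starE : @Eisenstein_star F V `<=` @Eisenstein F V by move=> x [].
have EE : @Eisenstein F V `<=` @Eisenstein F V by [].
rewrite (genericE char2 char3 e_basis) (stableE char2 char3 e_basis).
split; first exact: zeta_s_bij.
split; first exact: zeta_g_bij.
split; first exact: zeta_s_bij.
split; first exact: zeta_g_bij.
by split; [apply: Psi3_bij e_basis | apply: Psi3t_bij e_basis].
Qed.
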